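(* Let $\lambda>0$, $u(x)=\log\varphi(\sqrt\lambda\,x)$ and $S=YG$, where $G\sim N(0,1)$ and $Y\mid G\sim\mathrm{Rad}(\varphi(\sqrt\lambda G))$. There exists $\alpha_0=\alpha_0(\lambda)>0$ such that for all $0<\alpha<\alpha_0$ the saddle point problem $\sup_{x\in(-1,1)}\inf_{q\in[0,1)}\Phi(x,q)$ is uniquely achieved, at a pair $(x_{\rm Bayes},q_{\rm Bayes})$ which solves the system $$\alpha\lambda(1-q)\,\mathbb E\big[\varphi(-\sqrt\lambda\,YG)\,R(x,q)\big]=\frac x{1-x^2}\qquad\text{and}\qquad\alpha\lambda(1-x^2)\,\mathbb E\big[R(x,q)^2\big]=\frac q{(1-q)^2}.$$
   Context: $\varphi(x)=1/(1+e^{-x})$; $\mathrm{Rad}(p)$ is the law on $\{-1,+1\}$ giving mass $p$ to $+1$. $G,Z,W\sim N(0,1)$ are mutually independent, $Y\mid G\sim\mathrm{Rad}(\varphi(\sqrt\lambda G))$ independently of everything else, $\mathbb E_W$ is the expectation over $W$ only, and $\mathbb E$ averages over the remaining variables. Put $$V=xYG+\sqrt{(1-x^2)q}\,Z+\sqrt{(1-x^2)(1-q)}\,W,\qquad R(x,q)=\frac{\mathbb E_W\varphi'(\sqrt\lambda V)}{\mathbb E_W\varphi(\sqrt\lambda V)}.$$ For $(x,q)\in(-1,1)\times[0,1)$, $$\Phi(x,q)=\alpha\,\mathbb E\log\mathbb E_W\exp u\big(xS+\sqrt{(1-x^2)q}\,Z+\sqrt{(1-x^2)(1-q)}\,W\big)+\frac12\frac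 q{1-q}+\frac12\log\big((1-x^2)(1-q)\big).$$ The saddle point problem is uniquely achieved at $(x_\star,q_\star)$ if there is a unique $x_\star\in[0,1)$ achieving $\sup_{x\in(-1,1)}\inf_{q\in[0,1)}\Phi(x,q)$, and a unique $q_\star\in[0,1)$ achieving $\inf_{q\in[0,1)}\Phi(x_\star,q)$. *)

(* Defs.v *)
From HB Require Import structures.
From mathcomp Require Import all_boot all_order all_algebra.
From mathcomp Require Import all_classical all_reals all_analysis.

Set Implicit Arguments.
Unset Strict Implicit.
Unset Printing Implicit Defensive.

Import Order.TTheory GRing.Theory Num.Theory.
Import numFieldNormedType.Exports.

Local Open Scope classical_set_scope.
Local Open Scope ring_scope.

Definition phi {R : realType} (x : R) : R := 1 / (1 + expR (- x)).

Definition u {R : realType} (lambda x : R) : R :=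
  ln (phi (Num.sqrt lambda * x)).

Definition gauss {R : realType} : probability (measurableTypeR R) R :=
  normal_prob (0 : R) 1.

Definition spin {R : realType} (b : bool) : R := if b then 1 else -1.

Lemma measurable_spin {R : realType} :
  measurable_fun [set: bool] (@spin R : bool -> measurableTypeR R).
Proof. by []. Qed.

HB.instance Definition _ {R : realType} :=
  isMeasurableFun.Build _ _ _ _ (@spin R : bool -> measurableTypeR R)
    (@measurable_spin R).

(* [bernoulli_prob p] gives mass [p] to [true], for 0 <= p <= 1. *)
Definition Rad {R : realType} (p : R) : probability (measurableTypeR R) R :=
  distribution (bernoulli_prob p)
    ((@spin R : bool -> measurableTypeR R) : {mfun bool >-> measurableTypeR R}).

Definition EW {R : realType} (f : R -> R) : R := \int[gauss]_w f w.

(* Expectation of [f Y G Z] under the joint law of (Y, G, Z), disintegrated as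
   G ~ N(0,1), then Y | G ~ Rad (phi (sqrt lambda G)), then Z ~ N(0,1)
   independent of (Y, G). *)
Definition EYGZ {R : realType} (lambda : R) (f : R -> R -> R -> R) : R :=
  \int[gauss]_g \int[Rad (phi (Num.sqrt lambda * g))]_y \int[gauss]_z f y g z.

Definition V {R : realType} (x q y g z w : R) : R :=
  x * y * g + Num.sqrt ((1 - x ^+ 2) * q) * z
  + Num.sqrt ((1 - x ^+ 2) * (1 - q)) * w.

(* The random variable R(x, q), as a function of the values (y, g, z) of
   (Y, G, Z). *)
Definition Rratio {R : realType} (lambda x q y g z : R) : R :=
  EW (fun w => derive1 (@phi R) (Num.sqrt lambda * V x q y g z w))
  / EW (fun w => phi (Num.sqrt lambda * V x q y g z w)).

(* Since S = Y G, the argument of u in the potential is V. *)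
Definition Phi {R : realType} (lambda alpha x q : R) : R :=
  alpha * EYGZ lambda (fun y g z =>
            ln (EW (fun w => expR (u lambda (V x q y g z w)))))
  + 1 / 2 * (q / (1 - q)) + 1 / 2 * ln ((1 - x ^+ 2) * (1 - q)).

(* Infima and suprema are taken in the extended reals, so that no boundedness
   is presupposed. *)
Definition infq {R : realType} (F : R -> R -> R) (x : R) : \bar R :=
  ereal_inf [set (F x q)%:E | q in `[0, 1[].

Definition supinf {R : realType} (F : R -> R -> R) : \bar R :=
  ereal_sup [set infq F x | x in `]-1, 1[].

Definition uniquely_achieved {R : realType} (F : R -> R -> R) (xs qs : R) :=
  [set x | 0 <= x < 1 /\ infq F x = supinf F] = [set xs] /\
  [set q | 0 <= q < 1 /\ (F xs q)%:E = infq F xs] = [set qs].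

(* Main.v *)
(* The law of S = Y G has density 2 phi (sqrt lambda s) with respect to the
   standard Gaussian.  With q = t ^ 2, the expectation in Phi is an average of
   ln (E_W phi (m + c W)) with m = a S + b Z, where (a, b, c) runs over the
   sphere of radius sqrt lambda.  Gaussian integration by parts in S, Z and W
   turns its derivative along the sphere into a combination of
   A = E[phi(-sqrt lambda S) R] and B = E[R ^ 2] only, since the second-order
   terms are multiplied by a a' + b b' + c c' = 0.  Hence the stationarity
   equations of Phi are the two equations of the statement.  As all derivatives
   of phi are bounded by multiples of phi, A and B are bounded and Lipschitz in
   (x, q), uniformly on the whole domain.  So for small alpha the entropic terms
   dominate: the system has a solution (x, q) in [0, 1/2] ^ 2, Phi(., q) has its
   strict maximum at x and Phi(x, .) its strict minimum at q, and such a saddle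
   point is the unique solution of the sup-inf problem. *)

Require Import Defs.
From HB Require Import structures.
From mathcomp Require Import all_boot all_order all_algebra.
From mathcomp Require Import all_classical all_reals all_analysis.
From mathcomp Require Import measurable_realfun ring lra.

Set Implicit Arguments.
Unset Strict Implicit.
Unset Printing Implicit Defensive.

Import Order.TTheory GRing.Theory Num.Theory.
Import numFieldNormedType.Exports.

Local Open Scope classical_set_scope.
Local Open Scope ring_scope.

(** * The standard Gaussian expectation *)

(** The saddle inequalities are needed on the whole slices []-1, 1[] and [[0, 1[], so the Lipschitz
    bounds must survive at the boundary, where the square roots in [V] have unbounded derivatives.
    They survive because a standard deviation [s] acts on a Gaussian average only through [s^2]: its
    derivative along a curve is [s s'] times an average of second order, and on the sphere [s s'] is
    a polynomial in [x] and [t]. The coefficient [a] of the signal does act to first order, but it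
    is linear in [x]. In the variable [t] the products [s s'] carry a factor [t], which cancels the
    singularity of [sqrt q] at [q = 0]. Neither concavity in [x] nor convexity in [q] is
    established. On each of the two slices through the critical point, the derivative is compared
    with its value 0 there: the entropic part moves with slope at least 1, the rest with a Lipschitz
    constant below 1, so the derivative has a definite sign on either side. *)

Section gauss_expectation.
Context {R : realType}.
Local Notation mu := (@lebesgue_measure R).
Local Notation pdf := (normal_pdf (0 : R) 1).
Implicit Types f g h : R -> R.

Lemma gauss_pdfE (x : R) :
  pdf x = normal_peak 1 * expR (- (x ^+ 2 / 2)).
Proof.
rewrite normal_pdfE ?oner_neq0// /normal_fun subr0 expr1n mulNr.
by congr (_ * expR (- (_ / _))).
Qed.

Lemma gauss_dominates : @gauss R `<< mu.
Proof. exact: normal_prob_dominates. Qed.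

(** The Radon-Nikodym density is a chosen function known through its integrals over measurable sets;
    these determine it almost everywhere. *)
Lemma gauss_RN_ae : ae_eq mu setT
  (Radon_Nikodym_SigmaFinite.f (@gauss R) mu) (fun x => (pdf x)%:E).
Proof.
apply: integral_ae_eq => //.
- exact: Radon_Nikodym_SigmaFinite.f_integrable gauss_dominates.
- by apply/measurable_EFinP; exact: measurable_normal_pdf.
- move=> E _ mE.
  by rewrite -(Radon_Nikodym_SigmaFinite.f_integral gauss_dominates).
Qed.

Lemma ge0_integral_gauss f : measurable_fun setT f -> (forall x, 0 <= f x) ->
  (\int[gauss]_x (f x)%:E = \int[mu]_x (f x * pdf x)%:E)%E.
Proof.
move=> mf f0.
rewrite -(Radon_Nikodym_SigmaFinite.change_of_variables gauss_dominates)//;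
  last exact/measurable_EFinP.
apply: ae_eq_integral => //.
- apply: emeasurable_funM; first exact/measurable_EFinP.
  apply: measurable_int.
  exact: Radon_Nikodym_SigmaFinite.f_integrable gauss_dominates.
- apply/measurable_EFinP/measurable_funM => //.
  exact: measurable_normal_pdf.
- under [X in ae_eq _ _ _ X]eq_fun do rewrite EFinM.
  by apply: ae_eqe_mul2l; exact: gauss_RN_ae.
Qed.

Lemma abs_le_expR_sqr (x : R) : `|x| <= expR (x ^+ 2 / 4).
Proof.
rewrite (le_trans _ (expR_ge1Dx _))//.
have := sqr_ge0 (`|x| / 2 - 1); rewrite -(real_normK (num_real x)); lra.
Qed.

(** The bound [|x| <= exp (x^2 / 4)] spends half of the Gaussian decay; what remains is, up to the
    ratio [K] of the peaks, the centred Gaussian density of variance 2. *)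
Lemma integrable_norm_pdf : mu.-integrable setT (fun x => (`|x| * pdf x)%:E).
Proof.
pose C : R := Num.sqrt 2.
have C0 : C != 0 by rewrite gt_eqF// sqrtr_gt0.
pose K := normal_peak (1 : R) / normal_peak C.
have iK : mu.-integrable setT (fun x => (K%:E * (normal_pdf 0 C x)%:E)%E).
  by apply: integrableZl => //; exact: integrable_normal_pdf.
apply: le_integrable iK => //.
  apply/measurable_EFinP/measurable_funM; last exact: measurable_normal_pdf.
  exact: normr_measurable.
move=> x _ /=; rewrite lee_fin.
rewrite [leLHS]ger0_norm ?mulr_ge0 ?normal_pdf_ge0//.
rewrite [leRHS]ger0_norm ?mulr_ge0 ?normal_pdf_ge0 ?divr_ge0 ?invr_ge0 ?normal_peak_ge0//.
rewrite gauss_pdfE normal_pdfE// /normal_fun subr0 [leRHS]mulrA /K divfK; last first.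
  by rewrite gt_eqF ?normal_peak_gt0.
rewrite mulrCA ler_wpM2l ?normal_peak_ge0//.
apply: (@le_trans _ _ (expR (x ^+ 2 / 4) * expR (- (x ^+ 2 / 2)))).
  by rewrite ler_wpM2r ?expR_ge0// abs_le_expR_sqr.
rewrite -expRD ler_expR sqr_sqrtr//.
lra.
Qed.

Lemma integrable_gauss_norm : (@gauss R).-integrable setT (EFin \o Num.norm).
Proof.
apply/integrableP; split; first by apply/measurable_EFinP.
under eq_integral do rewrite /= normr_id.
rewrite ge0_integral_gauss//.
by have /integrableP[_] := integrable_norm_pdf;
  under eq_integral do rewrite /= ger0_norm ?mulr_ge0 ?normal_pdf_ge0//.
Qed.

(** Affine growth is the right class here: [lnP] grows at most linearly in its mean, its derivatives
    are bounded, and differentiating along a curve costs one factor of the Gaussian variable. *)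
Lemma integrable_gauss f (A B : R) : measurable_fun setT f ->
  (forall x, `|f x| <= A + B * `|x|) ->
  (@gauss R).-integrable setT (EFin \o f).
Proof.
move=> mf fAB.
have iA : (@gauss R).-integrable setT (fun x => (A%:E + B%:E * (`|x|)%:E)%E).
  apply: integrableD => //; last exact/integrableZl/integrable_gauss_norm.
  apply/integrableP; split => //=.
  rewrite integral_cst//= [X in (_ * X)%E](@probability_setT _ _ _ (@gauss R)).
  by rewrite mule1 ltry.
apply: le_integrable iA => //; first exact/measurable_EFinP.
by move=> x _; rewrite /= lee_fin (le_trans (fAB x))// ler_norm.
Qed.

Lemma integrable_gauss_bounded f (C : R) : measurable_fun setT f ->
  (forall x, `|f x| <= C) -> (@gauss R).-integrable setT (EFin \o f).
Proof.
move=> mf fC; apply: (@integrable_gauss f C 0) => // x.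
by rewrite mul0r addr0.
Qed.

(** Substitution and the fundamental theorem of calculus concern Lebesgue integrals; this is the
    bridge to them for [EW_sym] and [EW_Stein]. *)
Lemma EW_density f : (@gauss R).-integrable setT (EFin \o f) ->
  mu.-integrable setT (fun x => (f x * pdf x)%:E) /\
  EW f = \int[mu]_x (f x * pdf x).
Proof.
move=> fi.
have mf : measurable_fun setT f 
  by apply/measurable_EFinP; exact: measurable_int fi.
split.
  apply/integrableP; split.
    apply/measurable_EFinP/measurable_funM => //.
    exact: measurable_normal_pdf.
  move/integrableP : fi => [_].
  under eq_integral do rewrite /=.
  rewrite ge0_integral_gauss//; last exact: measurableT_comp.
  by under [in X in _ -> X]eq_integral do
    rewrite /= normrM (ger0_norm (normal_pdf_ge0 _ _ _)).
rewrite /EW /Rintegral; congr fine.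
rewrite -(Radon_Nikodym_change_of_variables gauss_dominates)//.
apply: ae_eq_integral => //.
- apply: emeasurable_funM; first exact/measurable_EFinP.
  apply: measurable_int.
  apply: Radon_Nikodym_integrable; exact: gauss_dominates.
- apply/measurable_EFinP/measurable_funM => //.
  exact: measurable_normal_pdf.
- under [X in ae_eq _ _ _ X]eq_fun do rewrite EFinM.
  apply: ae_eqe_mul2l.
  rewrite Radon_NikodymE//=; first exact: gauss_dominates.
  move=> gmu; case: cid => /= h [h1 h2 h3].
  apply: integral_ae_eq => //=.
  + by apply/measurable_EFinP; exact: measurable_normal_pdf.
  + by move=> E E01 mE; rewrite -h3.
Qed.

Lemma EWD f g : (@gauss R).-integrable setT (EFin \o f) ->
  (@gauss R).-integrable setT (EFin \o g) ->
  EW (fun x => f x + g x) = EW f + EW g.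
Proof. by move=> fi gi; rewrite /EW RintegralD. Qed.

Lemma EWB f g : (@gauss R).-integrable setT (EFin \o f) ->
  (@gauss R).-integrable setT (EFin \o g) ->
  EW (fun x => f x - g x) = EW f - EW g.
Proof. by move=> fi gi; rewrite /EW RintegralB. Qed.

Lemma EWZ (r : R) f : (@gauss R).-integrable setT (EFin \o f) ->
  EW (fun x => r * f x) = r * EW f.
Proof. by move=> fi; rewrite /EW RintegralZl. Qed.

Lemma EW_cst (r : R) : EW (fun=> r) = r.
Proof.
rewrite /EW Rintegral_cst//.
by rewrite [X in fine X](@probability_setT _ _ _ (@gauss R)) mulr1.
Qed.

Lemma EW_ge0 f : (forall x, 0 <= f x) -> 0 <= EW f.
Proof. by move=> f0; exact: Rintegral_ge0. Qed.

Lemma le_EW f g : (@gauss R).-integrable setT (EFin \o f) ->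
  (@gauss R).-integrable setT (EFin \o g) ->
  (forall x, f x <= g x) -> EW f <= EW g.
Proof. by move=> fi gi fg; exact: le_Rintegral. Qed.

Lemma EW_norm_le f (A B : R) : measurable_fun setT f ->
  (forall x, `|f x| <= A + B * `|x|) ->
  `|EW f| <= A + B * EW (fun x => `|x|).
Proof.
move=> mf fAB.
have fi := @integrable_gauss _ _ _ mf fAB.
rewrite (le_trans (le_normr_Rintegral _ _))//.
rewrite -[A in leRHS]EW_cst -EWZ; last exact: integrable_gauss_norm.
rewrite -EWD; last 2 first.
- by apply: (@integrable_gauss_bounded _ `|A|) => // x.
- exact: (integrableZl measurableT B integrable_gauss_norm).
apply: le_EW => //.
- apply: (@integrable_gauss _ A B) => [|x]; first exact: measurableT_comp.
  by rewrite normr_id.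
- apply: (@integrable_gauss _ `|A| `|B|) => [|x].
    by apply: measurable_funD => //; apply: measurable_funM.
  by rewrite (le_trans (ler_normD _ _))// normrM normr_id.
Qed.

Lemma EW_bounded f (C : R) : measurable_fun setT f ->
  (forall x, `|f x| <= C) -> `|EW f| <= C.
Proof.
move=> mf fC; have := @EW_norm_le f C 0 mf.
by rewrite mul0r addr0; apply => x; rewrite mul0r addr0.
Qed.

(** If [EW f] were 0, then [f] would vanish off a null set; positivity everywhere makes that set the
    whole line, which has mass 1. *)
Lemma EW_gt0 f : (@gauss R).-integrable setT (EFin \o f) ->
  (forall x, 0 < f x) -> 0 < EW f.
Proof.
move=> fi f0; rewrite lt_neqAle EW_ge0 ?andbT; last by move=> x; exact: ltW.
apply/eqP => Ef0.
have mf : measurable_fun setT (EFin \o f) by exact: measurable_int fi.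
have : (\int[gauss]_x `|(EFin \o f) x| = 0)%E.
  rewrite -[RHS]/(0%:E) Ef0 /EW /Rintegral fineK; last first.
    exact: integrable_fin_num.
  by apply: eq_integral => x _ /=; rewrite ger0_norm// ltW.
move/(ae_eq_integral_abs gauss measurableT mf).
case=> N [mN N0 /(_ _)] sub.
have NT : N = setT.
  by apply/seteqP; split => // x _; apply: sub => /= /(_ I) [] /eqP;
    rewrite gt_eqF.
by move: N0; rewrite NT [LHS](@probability_setT _ _ _ (@gauss R)) => -[] /eqP;
  rewrite oner_eq0.
Qed.

(** Dominated convergence reduces the line to compact intervals. Symmetric ones are chosen because
    reflection preserves them and the even density takes the same value at both ends. *)
Lemma cvg_Rintegral_symitv h : mu.-integrable setT (EFin \o h) ->
  (\int[mu]_(x in `[- n%:R, n%:R]) h x) @[n --> \oo] --> \int[mu]_x h x.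
Proof.
move=> hi.
have mh : measurable_fun setT (EFin \o h) by exact: measurable_int hi.
have gi : mu.-integrable setT (fun x => (`|h x|)%:E).
  apply: le_integrable hi => //; last by move=> x _ /=; rewrite normr_id.
  by apply/measurable_EFinP/measurableT_comp => //; exact/measurable_EFinP.
under eq_fun do rewrite Rintegral_mkcond.
apply: fine_cvg.
rewrite /Rintegral fineK; last exact: integrable_fin_num.
pose h_ n x := ((h \_ `[- n%:R, n%:R]) x)%:E.
have mh_ n : measurable_fun setT (h_ n).
  apply/measurable_EFinP/(measurable_restrictT _ _).1 => //.
  by apply: measurable_funTS; exact/measurable_EFinP.
have cvgh x : setT x -> h_ ^~ x @ \oo --> (h x)%:E.
  move=> _; apply: cvg_near_cst.
  exists (Num.trunc `|x|).+1 => // n /= xn.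
  rewrite /h_ patchE mem_set//= in_itv/= -ler_norml.
  by rewrite ltW// (lt_le_trans (truncnS_gt _))// ler_nat.
apply: (@dominated_cvg _ _ _ mu _ measurableT h_ _ (fun x => (`|h x|)%:E)).
- exact: mh_.
- by move=> x _; exact: cvgh.
- by [].
- exact: gi.
- move=> n x _; rewrite /h_ patchE; case: ifPn => // _.
  by rewrite /= normr0 lee_fin.
Qed.

Lemma continuous_pdf : continuous pdf.
Proof. by apply: continuous_normal_pdf; rewrite oner_neq0. Qed.

Lemma EW_sym f : continuous f -> (@gauss R).-integrable setT (EFin \o f) ->
  (@gauss R).-integrable setT (EFin \o (f \o -%R)) ->
  EW (fun x => f (- x)) = EW f.
Proof.
move=> cf fi fNi.
have [hi ->] := EW_density fNi; have [gi ->] := EW_density fi.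
have := cvg_Rintegral_symitv gi.
have -> : (fun n => \int[mu]_(x in `[- n%:R, n%:R]) (f x * pdf x)) =
    (fun n => \int[mu]_(x in `[- n%:R, n%:R]) (f (- x) * pdf x)).
  apply/funext => n; congr fine.
  have := @integration_by_substitution_oppr R (fun x => f x * pdf x)
    (- n%:R) n%:R.
  rewrite opprK => ->.
  - by apply: eq_integral => x _ /=; rewrite !gauss_pdfE sqrrN.
  - by rewrite ge0_cp.
  - apply: continuous_subspaceT => x.
    by apply: cvgM; [exact: cf|exact: continuous_pdf].
move=> gl; have hl := cvg_Rintegral_symitv hi.
exact: cvg_unique hl gl.
Qed.

Lemma is_derive_pdf (x : R) : is_derive x 1 pdf (- x * pdf x).
Proof.
have -> : pdf = (fun x => normal_peak 1 * expR (- (x ^+ 2 / 2))).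
  by apply/funext => y; exact: gauss_pdfE.
apply: is_derive_eq.
by rewrite /GRing.scale /= !mulr0 ?addr0 ?add0r; field.
Qed.

(** Since [pdf' = - x pdf], the integrand [(f1 - x f) pdf] is the derivative of [f pdf], so its
    integral over a symmetric interval is a boundary term, which tends to 0. *)
Lemma EW_Stein f f1 (C : R) : (forall x : R, is_derive x 1 f (f1 x)) ->
  continuous f1 -> (forall x, `|f x| <= C) -> (forall x, `|f1 x| <= C) ->
  EW (fun x => x * f x) = EW f1.
Proof.
move=> df cf1 fC f1C.
have C0 : 0 <= C by rewrite (le_trans _ (fC 0)).
have cf : continuous f.
  move=> x; apply: differentiable_continuous; apply/derivable1_diffP.
  by have [] := df x.
have mf := continuous_measurable_fun cf.
have mf1 := continuous_measurable_fun cf1.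
have f1i := integrable_gauss_bounded mf1 f1C.
have xfi : (@gauss R).-integrable setT (EFin \o (fun x => x * f x)).
  apply: (@integrable_gauss _ 0 C); first exact: measurable_funM.
  by move=> x; rewrite add0r normrM mulrC ler_wpM2r.
apply/eqP; rewrite eq_sym -subr_eq0 -EWB//; apply/eqP.
have gi : (@gauss R).-integrable setT (EFin \o (fun x => f1 x - x * f x)).
  exact: (integrableB measurableT f1i xfi).
have [hi ->] := EW_density gi.
have hl := cvg_Rintegral_symitv hi.
apply: (cvg_unique _ hl) => //.
(* One factor 2 bounds the difference of two values of [f], the other comes from
   [exp (- n^2 / 2) <= 2 / n]. *)
pose K := 2 * (2 * (C * normal_peak (1 : R))).
(* The shift by one makes every interval nondegenerate and matches [harmonic n = 1 / (n + 1)]. *)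
suff : (fun n => \int[mu]_(x in `[- n%:R, n%:R])
    ((f1 x - x * f x) * pdf x)) \o S @ \oo --> (0 : R).
  by rewrite cvg_shiftS.
have E n : \int[mu]_(x in `[- n.+1%:R, n.+1%:R]) ((f1 x - x * f x) * pdf x) =
    (f n.+1%:R - f (- n.+1%:R)) * pdf n.+1%:R.
  rewrite /Rintegral (@continuous_FTC2 _ _ (fun x => f x * pdf x)).
  - by rewrite /= !gauss_pdfE sqrrN mulrBl.
  - by rewrite -subr_gt0 opprK addr_gt0.
  - apply: continuous_subspaceT => x.
    apply: cvgM; last exact: continuous_pdf.
    by apply: cvgB; [exact: cf1|apply: cvgM; [exact: cvg_id|exact: cf]].
  - have cg : continuous (fun x => f x * pdf x).
      by move=> x; apply: cvgM; [exact: cf|exact: continuous_pdf].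
    split.
    + move=> x _; apply: derivableM; first by have [] := df x.
      by have [] := is_derive_pdf x.
    + exact/cvg_at_right_filter/cg.
    + exact/cvg_at_left_filter/cg.
  - move=> x _; rewrite derive1E.
    have := is_deriveM (df x) (is_derive_pdf x).
    move=> /(@derive_val _ _ _ _ _ _ _) ->.
    by rewrite /GRing.scale/=; ring.
apply: norm_cvg0.
apply: (@squeeze_cvgr _ _ _ _ (fun=> 0) (fun n => K * harmonic n)); last 2 first.
- exact: cvg_cst.
- by rewrite -[X in _ --> X](mulr0 K); apply: cvgM;
    [exact: cvg_cst|exact: cvg_harmonic].
near=> n; rewrite normr_ge0/= E normrM.
rewrite (ger0_norm (normal_pdf_ge0 _ _ _)) gauss_pdfE /K /harmonic/=.
have p0 := normal_peak_ge0 (1 : R).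
have e1 : expR (- (n.+1%:R ^+ 2 / 2)) <= 2 * n.+1%:R^-1 :> R.
  have n0 : 0 < 2 * n.+1%:R^-1 :> R by rewrite mulr_gt0 ?invr_gt0.
  rewrite expRN -[leRHS]invrK lef_pV2 ?posrE ?expR_gt0 ?invr_gt0//.
  rewrite invfM invrK (le_trans _ (expR_ge1Dx _))//.
  have : 0 <= n.+1%:R :> R by [].
  have := sqr_ge0 (n.+1%:R - 1 : R); lra.
have e2 : `|f n.+1%:R - f (- n.+1%:R)| <= 2 * C.
  rewrite (le_trans (ler_normB _ _))//.
  by have := fC n.+1%:R; have := fC (- n.+1%:R); lra.
rewrite [leRHS](_ : _ = (2 * C) * (normal_peak 1 * (2 * n.+1%:R^-1))); last ring.
apply: ler_pM => //; first by rewrite mulr_ge0// expR_ge0.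
by rewrite ler_wpM2l.
Unshelve. all: end_near. Qed.

(** Only [F'] needs a bound uniform in the parameter. The bound on [F] may depend on it, as happens
    for a [heat_smooth] function, whose value at mean 0 varies with [c] without a given uniform
    bound. *)
Lemma is_derive_EW (F F' : R -> R -> R) (a b t A B : R) :
  t \in `]a, b[ ->
  (forall s, s \in `]a, b[ -> forall w, is_derive s 1 (F^~ w) (F' s w)) ->
  (forall s, s \in `]a, b[ -> measurable_fun setT (F s)) ->
  (forall s, s \in `]a, b[ -> exists A B, forall w, `|F s w| <= A + B * `|w|) ->
  (forall s, s \in `]a, b[ -> forall w, `|F' s w| <= A + B * `|w|) ->
  is_derive t 1 (fun s => EW (F s)) (EW (F' t)).
Proof.
move=> tab dF mF bF bF'.
pose G (w : R) := `|A| + `|B| * `|w|.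
have p1E s w : s \in `]a, b[ -> partial1of2 F s w = F' s w.
  by move=> sab; rewrite partial1of2E; have [_ ->] := dF s sab w.
have Ia : [set` `]a, b[] t by [].
have h1 s : [set` `]a, b[] s -> (@gauss R).-integrable setT (EFin \o F s).
  move=> sab; have [A' [B' AB]] := bF s sab.
  exact: (@integrable_gauss _ A' B' (mF _ sab) AB).
have h2 s w : [set` `]a, b[] s -> setT w -> derivable (F^~ w) s 1.
  by move=> sab _; have [] := dF s sab w.
have h3 (w : R) : 0 <= G w by rewrite /G addr_ge0// mulr_ge0.
have h4 : (@gauss R).-integrable setT (EFin \o G).
  apply: (@integrable_gauss _ `|A| `|B|).
    by apply: measurable_funD => //; apply: measurable_funM.
  by move=> w; rewrite ger0_norm.
have h5 s w : [set` `]a, b[] s -> setT w -> `|partial1of2 F s w| <= G w.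
  move=> sab _; rewrite p1E// (le_trans (bF' s sab w))//.
  by rewrite lerD ?ler_norm// ler_wpM2r// ler_norm.
apply: DeriveDef.
  exact: (derivable_under_integral measurableT Ia h1 h2 h3 h4 h5).
rewrite -derive1E.
rewrite (differentiation_under_integral measurableT Ia h1 h2 h3 h4 h5).
by apply: eq_Rintegral => w _; rewrite p1E.
Qed.

Lemma continuous_EW (F : R -> R -> R) (C : R) :
  (forall w, continuous (F^~ w)) -> (forall s, measurable_fun setT (F s)) ->
  (forall s w, `|F s w| <= C) -> continuous (fun s => EW (F s)).
Proof.
move=> cF mF bF t.
have tI : t \in `]t - 1, t + 1[%classic.
  by rewrite inE/= in_itv/= ltrBlDr !ltrDl ltr01.
apply: (@continuity_under_integral R _ _ (@gauss R) F setT measurableT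
  (t - 1) (t + 1) _ _ (fun=> C) _ _ t tI).
- by move=> s _; exact: integrable_gauss_bounded (mF s) (bF s).
- by apply: aeW => w _ s _; exact: cF.
- by apply: (@integrable_gauss_bounded _ `|C|).
- by move=> s _; apply: aeW.
Qed.

End gauss_expectation.

(** * Functions of mean and standard deviation smoothed by a Gaussian *)

Section heat_smooth.
Context {R : realType}.
Implicit Types (k f : R -> R -> R) (m b c : R).

(* [kap] encodes the derivative in [c], as [c * kap m c]: in the heat-equation
   setting, differentiating in [c] costs one factor [c] and two derivatives. *)
Record heat_smooth (C : R) (k k1 k2 kap : R -> R -> R) : Prop := HeatSmooth {
  heat_curve : forall (m m' c c' : R -> R) (t u v M : R), t \in `]u, v[ ->
    (forall s, s \in `]u, v[ -> is_derive s 1 m (m' s)) ->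
    (forall s, s \in `]u, v[ -> is_derive s 1 c (c' s)) ->
    (forall s, s \in `]u, v[ -> [/\ `|m' s| <= M, `|c' s| <= M & `|c s| <= M]) ->
    is_derive t 1 (fun s => k (m s) (c s))
      (m' t * k1 (m t) (c t) + c t * c' t * kap (m t) (c t));
  heat_derive1 : forall c m, is_derive m 1 (k1^~ c) (k2 m c);
  heat_continuous2 : forall c, continuous (k2^~ c);
  heat_continuous_kap : forall c, continuous (kap^~ c);
  heat_bound1 : forall m c, `|k1 m c| <= C;
  heat_bound2 : forall m c, `|k2 m c| <= C;
  heat_bound_kap : forall m c, `|kap m c| <= C }.

Lemma is_derive_continuous (f f' : R -> R) :
  (forall x : R, is_derive x 1 f (f' x)) -> continuous f.
Proof.
move=> df x; apply: differentiable_continuous; apply/derivable1_diffP.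
by have [] := df x.
Qed.

Lemma continuous_affine (f : R -> R) (m b : R) :
  continuous f -> continuous (fun z => f (m + b * z)).
Proof.
move=> cf z; apply: (@continuous_comp _ _ _ (fun z => m + b * z) f); last exact: cf.
by apply: cvgD; [exact: cvg_cst|apply: cvgM; [exact: cvg_cst|exact: cvg_id]].
Qed.

(** The average over [Z]. The average over [W], of standard deviation [c], is meant to be inside [k]
    already, so that a logarithm or a quotient can stand between the two. *)
Definition gaussT k m b c : R := EW (fun z => k (m + b * z) c).

Lemma gaussT_bounded k (C m b c : R) : continuous (k^~ c) ->
  (forall m, `|k m c| <= C) -> `|gaussT k m b c| <= C.
Proof.
move=> ck kC; apply: EW_bounded => [|z]; last exact: kC.
apply: continuous_measurable_fun.
exact: (@continuous_affine (k^~ c)).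
Qed.

Lemma continuous_gaussT k (C b c : R) : continuous (k^~ c) ->
  (forall m, `|k m c| <= C) -> continuous (fun m => gaussT k m b c).
Proof.
move=> ck kC; apply: (@continuous_EW _ (fun m z => k (m + b * z) c) C).
- move=> z; apply: (_ : continuous (fun m => k (m + b * z) c)) => m.
  apply: (@continuous_comp _ _ _ (fun m => m + b * z) (k^~ c)); last exact: ck.
  by apply: cvgD; [exact: cvg_id|exact: cvg_cst].
- move=> m; apply: continuous_measurable_fun.
  exact: (@continuous_affine (k^~ c)).
- by move=> m z; exact: kC.
Qed.

Section theory.
Variables (C : R) (k k1 k2 kap : R -> R -> R).
Hypothesis hk : heat_smooth C k k1 k2 kap.

Let C0 : 0 <= C. Proof. exact: le_trans (heat_bound1 hk 0 0). Qed.

Lemma heat_derive c m : is_derive m 1 (k^~ c) (k1 m c).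
Proof.
have mI : m \in `]m - 1, m + 1[ by rewrite in_itv/= ltrBlDr !ltrDl ltr01.
have := @heat_curve _ _ _ _ _ hk id (fun=> 1) (fun=> c) (fun=> 0) m
  (m - 1) (m + 1) (`|c| + 1) mI.
rewrite mulr0 mul0r addr0 mul1r; apply => s _.
by rewrite normr1 normr0 lerDr lerDl ler01 normr_ge0 addr_ge0.
Qed.

Lemma heat_continuous c : continuous (k^~ c).
Proof. exact: is_derive_continuous (heat_derive c). Qed.

Lemma heat_continuous1 c : continuous (k1^~ c).
Proof. exact: (is_derive_continuous (fun x => heat_derive1 hk c x)). Qed.

Lemma heat_growth m c : `|k m c| <= `|k 0 c| + C * `|m|.
Proof.
rewrite -lerBlDl (le_trans (lerB_dist _ _))//.
have dk (x : R) : is_derive x 1 (k^~ c) (k1 x c) by exact: heat_derive.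
have ck : {within `[0, m], continuous (k^~ c)} /\
          {within `[m, 0], continuous (k^~ c)}.
  by split; apply/continuous_subspaceT => x; exact: heat_continuous.
have [m0|m0] := leP 0 m.
  have [x _ ->] := MVT_segment m0 (fun x _ => dk x) ck.1.
  by rewrite subr0 normrM ler_wpM2r// (heat_bound1 hk).
have [x _] := MVT_segment (ltW m0) (fun x _ => dk x) ck.2.
rewrite distrC => ->.
by rewrite sub0r normrM normrN ler_wpM2r// (heat_bound1 hk).
Qed.

Lemma gaussT_growth m b c :
  `|gaussT k m b c| <= `|k 0 c| + C * `|m| + C * `|b| * EW (fun z => `|z|).
Proof.
apply: EW_norm_le => [|z].
  by apply: continuous_measurable_fun;
    exact: (@continuous_affine (k^~ c) _ _ (@heat_continuous c)).
rewrite (le_trans (heat_growth _ _))// -addrA lerD2l -mulrA -mulrDr ler_wpM2l//.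
by rewrite -normrM ler_normD.
Qed.

Lemma gaussT_Stein m b c :
  EW (fun z => z * k1 (m + b * z) c) = b * gaussT k2 m b c.
Proof.
have c2 : continuous (k2^~ c) by exact: (heat_continuous2 hk).
rewrite /gaussT -EWZ; last first.
  apply: (@integrable_gauss_bounded _ _ C) => [|z]; last exact: (heat_bound2 hk).
  by apply: continuous_measurable_fun; exact: (@continuous_affine (k2^~ c)).
apply: (@EW_Stein _ _ _ (C + `|b| * C)).
- move=> z; have dk1 : is_derive (m + b * z) 1 (k1^~ c) (k2 (m + b * z) c).
    exact: (heat_derive1 hk).
  have da : is_derive z 1 (fun z => m + b * z) b.
    by apply: is_derive_eq; rewrite /GRing.scale/=; ring.
  have := @is_derive1_comp R (k1^~ c) (fun z => m + b * z) z _ _ dk1 da.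
  by rewrite mulrC.
- move=> z; apply: cvgM; first exact: cvg_cst.
  exact: (@continuous_affine (k2^~ c)).
- move=> z; rewrite (le_trans (heat_bound1 hk _ _))// lerDl mulr_ge0//.
- move=> z; rewrite normrM (@le_trans _ _ (`|b| * C))//.
    by rewrite ler_wpM2l// (heat_bound2 hk).
  by rewrite lerDr.
Qed.

(** The chain rule for fixed [z] yields a term [b' z k1], which Stein's identity turns into
    [b b' k2]. Thus [b] acts, like [c], only through its square. *)
Lemma is_derive_gaussT (m m' b b' c c' : R -> R) (t u v M : R) :
  t \in `]u, v[ ->
  (forall s, s \in `]u, v[ -> is_derive s 1 m (m' s)) ->
  (forall s, s \in `]u, v[ -> is_derive s 1 b (b' s)) ->
  (forall s, s \in `]u, v[ -> is_derive s 1 c (c' s)) ->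
  (forall s, s \in `]u, v[ ->
    [/\ `|m' s| <= M, `|b' s| <= M, `|c' s| <= M & `|c s| <= M]) ->
  is_derive t 1 (fun s => gaussT k (m s) (b s) (c s))
    (m' t * gaussT k1 (m t) (b t) (c t) + b t * b' t * gaussT k2 (m t) (b t) (c t)
     + c t * c' t * gaussT kap (m t) (b t) (c t)).
Proof.
move=> tuv dm db dc bM.
pose F s z := k (m s + b s * z) (c s).
pose F' s z := (m' s + b' s * z) * k1 (m s + b s * z) (c s) +
  c s * c' s * kap (m s + b s * z) (c s).
have M0 : 0 <= M by have [+ _ _ _] := bM t tuv; exact: le_trans.
have cont (h : R -> R -> R) s : continuous (h^~ (c s)) ->
    measurable_fun setT (fun z => h (m s + b s * z) (c s)).
  by move=> ch; apply: continuous_measurable_fun;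
    exact: (@continuous_affine (h^~ (c s))).
have : is_derive t 1 (fun s => EW (F s)) (EW (F' t)).
  apply: (@is_derive_EW _ F F' u v t (M * C + M * M * C) (M * C) tuv).
  - move=> s suv z.
    (* The bound on the curve grows with [z], which is harmless: the [M] of [heat_curve] is
       arbitrary and does not appear in its conclusion. *)
    apply: (@heat_curve _ _ _ _ _ hk (fun s => m s + b s * z)
      (fun s => m' s + b' s * z) c c' s u v (M + M * `|z|) suv) => // r ruv.
      have := dm r ruv; have := db r ruv => dbr dmr.
      by apply: is_derive_eq; rewrite /GRing.scale/=; ring.
    have [h1 h2 h3 h4] := bM r ruv; split.
    + rewrite (le_trans (ler_normD _ _))// lerD// normrM.
      by rewrite ler_wpM2r.
    + by rewrite (le_trans h3)// lerDl mulr_ge0.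
    + by rewrite (le_trans h4)// lerDl mulr_ge0.
  - move=> s suv; apply: cont; exact: heat_continuous.
  - move=> s suv; exists (`|k 0 (c s)| + C * `|m s|), (C * `|b s|) => z.
    rewrite (le_trans (heat_growth _ _))// -addrA lerD2l -mulrA -mulrDr.
    by rewrite ler_wpM2l// -normrM ler_normD.
  - move=> s suv z; have [h1 h2 h3 h4] := bM s suv.
    rewrite (le_trans (ler_normD _ _))//.
    rewrite (_ : _ + _ + _ = (M + M * `|z|) * C + M * M * C); last ring.
    rewrite lerD// !normrM ler_pM ?mulr_ge0 ?(heat_bound1 hk) ?(heat_bound_kap hk)//.
      by rewrite (le_trans (ler_normD _ _))// lerD// normrM ler_wpM2r.
    by rewrite ler_pM.
move=> /is_derive_eq; apply.
have i1 : (@gauss R).-integrable setT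
    (EFin \o (fun z => k1 (m t + b t * z) (c t))).
  apply: (@integrable_gauss_bounded _ _ C) => [|z]; last exact: (heat_bound1 hk).
  by apply: (cont k1); exact: heat_continuous1.
have i1z : (@gauss R).-integrable setT
    (EFin \o (fun z => z * k1 (m t + b t * z) (c t))).
  apply: (@integrable_gauss _ _ 0 C) => [|z].
    by apply: measurable_funM => //; apply: (cont k1); exact: heat_continuous1.
  by rewrite add0r normrM mulrC ler_wpM2r// (heat_bound1 hk).
have i2 : (@gauss R).-integrable setT
    (EFin \o (fun z => kap (m t + b t * z) (c t))).
  apply: (@integrable_gauss_bounded _ _ C) => [|z]; last exact: (heat_bound_kap hk).
  by apply: (cont kap); exact: (heat_continuous_kap hk).
have FE : F' t = fun z => (m' t * k1 (m t + b t * z) (c t) +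
    b' t * (z * k1 (m t + b t * z) (c t))) +
    c t * c' t * kap (m t + b t * z) (c t).
  by apply/funext => z; rewrite /F'; ring.
rewrite FE.
have j1 := integrableZl measurableT (m' t) i1.
have j2 := integrableZl measurableT (b' t) i1z.
have j3 := integrableZl measurableT (c t * c' t) i2.
rewrite EWD//; last exact: (integrableD measurableT j1 j2).
rewrite EWD// !EWZ// gaussT_Stein /gaussT; ring.
Qed.

End theory.
End heat_smooth.

(** * Weighted averages over the signal variable *)

Section gaussJ.
Context {R : realType}.
Implicit Types (om : R -> R) (k : R -> R -> R) (a b c : R).

(** The weight [om] carries the law of [S] as a density with respect to the standard Gaussian, so
    all three averages are Gaussian. *)
Definition gaussJ om k a b c : R := EW (fun g => om g * gaussT k (a * g) b c).

Lemma continuous_gaussT_scale k (C a b c : R) : continuous (k^~ c) ->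
  (forall m, `|k m c| <= C) -> continuous (fun g => gaussT k (a * g) b c).
Proof.
move=> ck kC g.
apply: (@continuous_comp _ _ _ (fun g => a * g) (fun m => gaussT k m b c)).
  by apply: cvgM; [exact: cvg_cst|exact: cvg_id].
exact: (continuous_gaussT ck kC).
Qed.

Lemma integrable_gaussJ om k (W C a b c : R) : continuous om ->
  (forall g, `|om g| <= W) -> continuous (k^~ c) ->
  (forall m, `|k m c| <= C) ->
  (@gauss R).-integrable setT
    (EFin \o (fun g => om g * gaussT k (a * g) b c)).
Proof.
move=> com omW ck kC.
apply: (@integrable_gauss_bounded _ _ (W * C)) => [|g].
  apply: measurable_funM; first exact: continuous_measurable_fun.
  by apply: continuous_measurable_fun; exact: (continuous_gaussT_scale ck kC).
by rewrite normrM ler_pM// gaussT_bounded.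
Qed.

Lemma gaussJ_bounded om k (W C a b c : R) : continuous om ->
  (forall g, `|om g| <= W) -> continuous (k^~ c) ->
  (forall m, `|k m c| <= C) -> `|gaussJ om k a b c| <= W * C.
Proof.
move=> com omW ck kC; apply: EW_bounded => [|g].
  apply: measurable_funM; first exact: continuous_measurable_fun.
  by apply: continuous_measurable_fun; exact: (continuous_gaussT_scale ck kC).
by rewrite normrM ler_pM// gaussT_bounded.
Qed.

Section theory.
Variables (C : R) (k k1 k2 kap : R -> R -> R).
Hypothesis hk : heat_smooth C k k1 k2 kap.
Variables (W : R) (om : R -> R).
Hypothesis com : continuous om.
Hypothesis omW : forall g, `|om g| <= W.

Let C0 : 0 <= C. Proof. exact: le_trans (heat_bound1 hk 0 0). Qed.
Let W0 : 0 <= W. Proof. exact: le_trans (omW 0). Qed.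

Lemma is_derive_gaussT_mean (h h1 : R -> R -> R) (D m b c : R) :
  (forall x : R, is_derive x 1 (h^~ c) (h1 x c)) ->
  (forall x, `|h1 x c| <= C) -> (forall x, `|h x c| <= D + C * `|x|) ->
  is_derive m 1 (fun m => gaussT h m b c) (gaussT h1 m b c).
Proof.
move=> dh h1C hC.
have mI : m \in `]m - 1, m + 1[ by rewrite in_itv/= ltrBlDr !ltrDl ltr01.
apply: (@is_derive_EW _ (fun m z => h (m + b * z) c)
  (fun m z => h1 (m + b * z) c) _ _ m C 0 mI).
- move=> s _ z; have dk1 := dh (s + b * z).
  have da : is_derive s 1 (fun s => s + b * z) 1.
    by apply: is_derive_eq; rewrite addr0.
  have := @is_derive1_comp R (h^~ c) (fun s => s + b * z) s _ _ dk1 da.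
  by rewrite mulr1.
- move=> s _; apply: continuous_measurable_fun.
  by apply: (@continuous_affine _ (h^~ c)); exact: is_derive_continuous dh.
- move=> s _; exists (D + C * `|s|), (C * `|b|) => z.
  rewrite (le_trans (hC _))// -addrA lerD2l -mulrA -mulrDr ler_wpM2l//.
  by rewrite -normrM ler_normD.
- by move=> s _ z; rewrite mul0r addr0.
Qed.

Lemma is_derive_gaussT0 (m b c : R) :
  is_derive m 1 (fun m => gaussT k m b c) (gaussT k1 m b c).
Proof.
apply: (@is_derive_gaussT_mean _ _ `|k 0 c|) => x; first exact: (heat_derive hk).
- exact: (heat_bound1 hk).
- exact: (heat_growth hk).
Qed.

Lemma is_derive_gaussT1 (m b c : R) :
  is_derive m 1 (fun m => gaussT k1 m b c) (gaussT k2 m b c).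
Proof.
apply: (@is_derive_gaussT_mean _ _ C) => x; first exact: (heat_derive1 hk).
- exact: (heat_bound2 hk).
- by rewrite (le_trans (heat_bound1 hk _ _))// lerDl mulr_ge0.
Qed.

(** The derivative falls on the weight as well as on the inner average. The weight term is of first
    order in [k] and is the origin of the signal expectation A. *)
Lemma gaussJ_Stein om1 a b c : (forall g : R, is_derive g 1 om (om1 g)) ->
  continuous om1 -> (forall g, `|om1 g| <= W) ->
  EW (fun g => om g * (g * gaussT k1 (a * g) b c)) =
  gaussJ om1 k1 a b c + a * gaussJ om k2 a b c.
Proof.
move=> dom com1 om1W.
have c1 : continuous (k1^~ c) by exact: (heat_continuous1 hk).
have c2 : continuous (k2^~ c) by exact: (heat_continuous2 hk).
have b1 m : `|k1 m c| <= C by exact: (heat_bound1 hk).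
have b2 m : `|k2 m c| <= C by exact: (heat_bound2 hk).
have i1 := integrable_gaussJ a b com1 om1W c1 b1.
have i2 := integrable_gaussJ a b com omW c2 b2.
rewrite /gaussJ -EWZ// -EWD//; last exact: (integrableZl measurableT a i2).
under [in LHS]eq_fun do rewrite mulrCA.
apply: (@EW_Stein _ (fun g => om g * gaussT k1 (a * g) b c) _
    (W * C + `|a| * (W * C))).
- move=> g; have domg := dom g.
  have dT := is_derive_gaussT1 (a * g) b c.
  have da : is_derive g 1 (fun g => a * g) a.
    by apply: is_derive_eq; rewrite /GRing.scale/=; ring.
  have dc := @is_derive1_comp R (fun m => gaussT k1 m b c) (fun g => a * g)
    g _ _ dT da.
  have := is_deriveM domg dc => /is_derive_eq; apply.
  by rewrite /GRing.scale/=; ring.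
- have co1 : continuous (fun g => om1 g * gaussT k1 (a * g) b c).
    move=> g; apply: cvgM; first exact: com1.
    exact: (continuous_gaussT_scale c1 b1).
  have co2 : continuous (fun g => om g * gaussT k2 (a * g) b c).
    move=> g; apply: cvgM; first exact: com.
    exact: (continuous_gaussT_scale c2 b2).
  move=> g; apply: cvgD; first exact: co1.
  by apply: cvgM; [exact: cvg_cst|exact: co2].
- move=> g; rewrite normrM (@le_trans _ _ (W * C))//.
    by rewrite ler_pM// gaussT_bounded.
  by rewrite lerDl !mulr_ge0.
- move=> g; rewrite (le_trans (ler_normD _ _))// lerD// !normrM.
    by rewrite ler_pM// gaussT_bounded.
  by rewrite ler_wpM2l// ler_pM// gaussT_bounded.
Qed.

(** The term in [a'] keeps its factor [g]: boundedness of the derivative then follows from [E |g|]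
    alone, with no differentiability of [om]. [gaussJ_Stein] is applied afterwards where an exact
    formula is wanted. *)
Lemma is_derive_gaussJ (a a' b b' c c' : R -> R) (t u v M : R) :
  t \in `]u, v[ ->
  (forall s, s \in `]u, v[ -> is_derive s 1 a (a' s)) ->
  (forall s, s \in `]u, v[ -> is_derive s 1 b (b' s)) ->
  (forall s, s \in `]u, v[ -> is_derive s 1 c (c' s)) ->
  (forall s, s \in `]u, v[ ->
    [/\ `|a' s| <= M, `|b' s| <= M, `|c' s| <= M, `|b s| <= M & `|c s| <= M]) ->
  is_derive t 1 (fun s => gaussJ om k (a s) (b s) (c s))
    (a' t * EW (fun g => om g * (g * gaussT k1 (a t * g) (b t) (c t)))
     + b t * b' t * gaussJ om k2 (a t) (b t) (c t)
     + c t * c' t * gaussJ om kap (a t) (b t) (c t)).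
Proof.
move=> tuv da db dc bM.
have M0 : 0 <= M by have [+ _ _ _ _] := bM t tuv; exact: le_trans.
have c1 c0 : continuous (k1^~ c0) by exact: (heat_continuous1 hk).
have c2 c0 : continuous (k2^~ c0) by exact: (heat_continuous2 hk).
have ck c0 : continuous (kap^~ c0) by exact: (heat_continuous_kap hk).
have b1 c0 m : `|k1 m c0| <= C by exact: (heat_bound1 hk).
have b2 c0 m : `|k2 m c0| <= C by exact: (heat_bound2 hk).
have bk c0 m : `|kap m c0| <= C by exact: (heat_bound_kap hk).
pose F s g := om g * gaussT k (a s * g) (b s) (c s).
pose F' s g := om g * (a' s * g * gaussT k1 (a s * g) (b s) (c s) +
  b s * b' s * gaussT k2 (a s * g) (b s) (c s) +
  c s * c' s * gaussT kap (a s * g) (b s) (c s)).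
have mom : measurable_fun setT om by exact: continuous_measurable_fun.
have : is_derive t 1 (fun s => EW (F s)) (EW (F' t)).
  apply: (@is_derive_EW _ F F' u v t (W * (M * M * C + M * M * C))
    (W * (M * C)) tuv).
  - move=> s suv g.
    have := @is_derive_gaussT _ _ _ _ _ _ hk (fun s => a s * g)
      (fun s => a' s * g) b b' c c' s u v (M * (`|g| + 1)) suv.
    move=> /(_ _ db dc) dT.
    have {}dT : is_derive s 1 (fun s => gaussT k (a s * g) (b s) (c s))
        (a' s * g * gaussT k1 (a s * g) (b s) (c s) +
         b s * b' s * gaussT k2 (a s * g) (b s) (c s) +
         c s * c' s * gaussT kap (a s * g) (b s) (c s)).
      apply: dT => r ruv.
        have dar := da r ruv.
        by apply: is_derive_eq; rewrite /GRing.scale/=; ring.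
      have [h1 h2 h3 _ h5] := bM r ruv.
      have MM : M <= M * (`|g| + 1) by rewrite mulrDr mulr1 lerDr mulr_ge0.
      split; [|exact: le_trans MM..].
      by rewrite normrM ler_pM// lerDl.
    apply: is_derive_eq.
    by [].
  - move=> s suv; apply: measurable_funM => //.
    apply: continuous_measurable_fun.
    move=> g.
    apply: (@continuous_comp _ _ _ (fun g => a s * g)
      (fun m => gaussT k m (b s) (c s))).
      by apply: cvgM; [exact: cvg_cst|exact: cvg_id].
    exact: (is_derive_continuous (fun m => is_derive_gaussT0 m (b s) (c s))).
  - move=> s suv; exists (W * (`|k 0 (c s)| + C * `|b s| * EW (fun z => `|z|))),
      (W * (C * `|a s|)) => g.
    rewrite /F normrM -(mulrA W) -mulrDr ler_pM//.
    rewrite (le_trans (gaussT_growth hk _ _ _))// normrM mulrA addrAC lexx//.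
  - move=> s suv g; have [h1 h2 h3 h4 h5] := bM s suv.
    rewrite /F' normrM -(mulrA W) -mulrDr ler_pM//.
    have t1 : `|a' s * g * gaussT k1 (a s * g) (b s) (c s)| <= M * C * `|g|.
      by rewrite mulrAC !normrM ler_wpM2r// ler_pM// gaussT_bounded.
    have t2 : `|b s * b' s * gaussT k2 (a s * g) (b s) (c s)| <= M * M * C.
      by rewrite !normrM ler_pM// ?mulr_ge0// ?gaussT_bounded// ler_pM.
    have t3 : `|c s * c' s * gaussT kap (a s * g) (b s) (c s)| <= M * M * C.
      by rewrite !normrM ler_pM// ?mulr_ge0// ?gaussT_bounded// ler_pM.
    rewrite (le_trans (ler_normD _ _))// (le_trans (lerD (ler_normD _ _) (lexx _)))//.
    lra.
move=> /is_derive_eq; apply.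
have i1 : (@gauss R).-integrable setT
    (EFin \o (fun g => om g * (g * gaussT k1 (a t * g) (b t) (c t)))).
  apply: (@integrable_gauss _ _ 0 (W * C)) => [|g].
    apply: measurable_funM => //; apply: measurable_funM => //.
    apply: continuous_measurable_fun.
    by apply: (continuous_gaussT_scale (c1 _)); exact: b1.
  by rewrite add0r !normrM -mulrA ler_pM// mulrC ler_wpM2r// gaussT_bounded.
have i2 := integrable_gaussJ (a t) (b t) com omW (c2 (c t)) (b2 _).
have i3 := integrable_gaussJ (a t) (b t) com omW (ck (c t)) (bk _).
have FE : F' t = fun g => (a' t * (om g * (g * gaussT k1 (a t * g) (b t) (c t))) +
    b t * b' t * (om g * gaussT k2 (a t * g) (b t) (c t))) +
    c t * c' t * (om g * gaussT kap (a t * g) (b t) (c t)).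
  by apply/funext => g; rewrite /F'; ring.
rewrite FE.
have j1 := integrableZl measurableT (a' t) i1.
have j2 := integrableZl measurableT (b t * b' t) i2.
have j3 := integrableZl measurableT (c t * c' t) i3.
rewrite EWD//; last exact: (integrableD measurableT j1 j2).
by rewrite EWD// !EWZ.
Qed.

End theory.
End gaussJ.

(** * The sigmoid and the ratios of its Gaussian averages *)

Section sigmoid.
Context {R : realType}.
Implicit Types x m c : R.

(** The first three derivatives of [phi], as polynomials in [phi]. Order three is reached because
    differentiating the average of [phi1] in its standard deviation costs two derivatives. *)
Definition phi1 x : R := phi x * (1 - phi x).
Definition phi2 x : R := phi1 x * (1 - 2 * phi x).
Definition phi3 x : R := phi1 x * (1 - 6 * phi1 x).

Lemma phi_gt0 x : 0 < phi x.
Proof. by rewrite /phi divr_gt0// addr_gt0// expR_gt0. Qed.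

Lemma phi_lt1 x : phi x < 1.
Proof.
by rewrite /phi ltr_pdivrMr ?addr_gt0 ?expR_gt0// mul1r ltrDl expR_gt0.
Qed.

Lemma phiN x : phi (- x) = 1 - phi x.
Proof.
rewrite /phi opprK expRN.
have e0 := expR_gt0 x; field.
by rewrite !gt_eqF// addr_gt0.
Qed.

Lemma is_derive_phi x : is_derive x 1 phi (phi1 x).
Proof.
have e0 : 1 + expR (- x) != 0 by rewrite gt_eqF// addr_gt0// expR_gt0.
have -> : phi = (fun x : R => (1 + expR (- x))^-1).
  by apply/funext => y; rewrite /phi div1r.
apply: is_derive_eq.
rewrite /phi1 /phi /GRing.scale/=.
by field.
Qed.

Lemma derive1_phi : derive1 (@phi R) = phi1.
Proof.
by apply/funext => x; rewrite derive1E; have [_ ->] := is_derive_phi x.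
Qed.

Lemma is_derive_phi1 x : is_derive x 1 phi1 (phi2 x).
Proof.
have d := is_derive_phi x; rewrite /phi1; apply: is_derive_eq.
by rewrite /phi2 /phi1 /GRing.scale/=; ring.
Qed.

Lemma is_derive_phi2 x : is_derive x 1 phi2 (phi3 x).
Proof.
have d := is_derive_phi x; have d1 := is_derive_phi1 x.
rewrite /phi2; apply: is_derive_eq.
by rewrite /phi3 /phi2 /phi1 /GRing.scale/=; ring.
Qed.

Lemma continuous_phi : continuous (@phi R).
Proof. exact: is_derive_continuous is_derive_phi. Qed.

Lemma continuous_phi1 : continuous phi1.
Proof. exact: is_derive_continuous is_derive_phi1. Qed.

Lemma continuous_phi2 : continuous phi2.
Proof. exact: is_derive_continuous is_derive_phi2. Qed.

Lemma continuous_phi3 : continuous phi3.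
Proof.
move=> x; apply: cvgM; first exact: continuous_phi1.
apply: cvgB; first exact: cvg_cst.
by apply: cvgM; [exact: cvg_cst|exact: continuous_phi1].
Qed.

Lemma phi1_gt0 x : 0 < phi1 x.
Proof. by rewrite /phi1 mulr_gt0 ?phi_gt0// subr_gt0 phi_lt1. Qed.

Lemma norm_phi_le1 x : `|phi x| <= 1.
Proof. by rewrite ger0_norm ltW ?phi_gt0 ?phi_lt1. Qed.

Lemma norm_phi1 x : `|phi1 x| <= phi x.
Proof.
have := phi_gt0 x; have := phi_lt1 x => h1 h0.
by rewrite ger0_norm ?(ltW (phi1_gt0 _))// /phi1; nra.
Qed.

Lemma norm_phi2 x : `|phi2 x| <= phi x.
Proof.
have h1 := phi_lt1 x; have h0 := phi_gt0 x.
rewrite /phi2 normrM (le_trans _ (norm_phi1 x))// ler_piMr// ler_norml.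
by apply/andP; split; nra.
Qed.

Lemma norm_phi3 x : `|phi3 x| <= phi x.
Proof.
have h1 := phi_lt1 x; have h0 := phi_gt0 x; have hp := phi1_gt0 x.
rewrite /phi3 normrM (le_trans _ (norm_phi1 x))// ler_piMr// ler_norml.
(* Hence [1 - 6 phi1] lies between [-1/2] and 1. *)
have : phi1 x <= 4^-1 by rewrite /phi1; have := sqr_ge0 (phi x - 2^-1); lra.
by move=> ?; apply/andP; split; lra.
Qed.

Lemma heat_smooth_cst (C : R) (f f1 f2 : R -> R) :
  (forall x : R, is_derive x 1 f (f1 x)) ->
  (forall x : R, is_derive x 1 f1 (f2 x)) -> continuous f2 ->
  (forall x, `|f1 x| <= C) -> (forall x, `|f2 x| <= C) ->
  heat_smooth C (fun m _ => f m) (fun m _ => f1 m) (fun m _ => f2 m)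
    (fun _ _ => 0).
Proof.
move=> df df1 cf2 b1 b2; split => //.
- move=> m m' c c' t u v M tuv dm dc _.
  have dft := df (m t); have dmt := dm t tuv.
  have := @is_derive1_comp R f m t _ _ dft dmt.
  by rewrite mulr0 addr0 mulrC.
- by move=> _ m; exact: cvg_cst.
- by move=> _ _; rewrite normr0; exact: le_trans (b1 0).
Qed.

(** The average over [W] is a [gaussT] with [c] in the place of [b] and a dummy last argument. Its
    heat equation is then the Stein term of [is_derive_gaussT]. *)
Definition gaussP (f : R -> R) m c : R := gaussT (fun m _ => f m) m c 0.

Lemma gaussPE f m c : gaussP f m c = EW (fun w => f (m + c * w)).
Proof. by []. Qed.

Lemma gaussP_curve (C : R) (f f1 f2 : R -> R) (m m' c c' : R -> R)
    (t u v M : R) :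
  (forall x : R, is_derive x 1 f (f1 x)) ->
  (forall x : R, is_derive x 1 f1 (f2 x)) -> continuous f2 ->
  (forall x, `|f1 x| <= C) -> (forall x, `|f2 x| <= C) ->
  t \in `]u, v[ ->
  (forall s, s \in `]u, v[ -> is_derive s 1 m (m' s)) ->
  (forall s, s \in `]u, v[ -> is_derive s 1 c (c' s)) ->
  (forall s, s \in `]u, v[ -> [/\ `|m' s| <= M, `|c' s| <= M & `|c s| <= M]) ->
  is_derive t 1 (fun s => gaussP f (m s) (c s))
    (m' t * gaussP f1 (m t) (c t) + c t * c' t * gaussP f2 (m t) (c t)).
Proof.
move=> df df1 cf2 b1 b2 tuv dm dc bM.
have hs := heat_smooth_cst df df1 cf2 b1 b2.
have d0 s : s \in `]u, v[ -> is_derive s 1 (fun=> 0 : R) 0.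
  by move=> _; exact: is_derive_cst.
have b0 s : s \in `]u, v[ ->
    [/\ `|m' s| <= M, `|c' s| <= M, `|0 : R| <= M & `|0 : R| <= M].
  move=> suv; have [h1 h2 _] := bM s suv.
  by rewrite h1 h2 normr0 (le_trans _ h1).
apply: is_derive_eq (is_derive_gaussT hs tuv dm dc d0 b0) _.
by rewrite /gaussP; ring.
Qed.

Lemma integrable_affine f (C m c : R) : continuous f ->
  (forall x, `|f x| <= C) ->
  (@gauss R).-integrable setT (EFin \o (fun w => f (m + c * w))).
Proof.
move=> cf fC; apply: (@integrable_gauss_bounded _ _ C) => [|w]; last exact: fC.
by apply: continuous_measurable_fun; exact: continuous_affine.
Qed.

Lemma gaussP_phi_gt0 m c : 0 < gaussP phi m c.
Proof.
apply: EW_gt0 => [|w]; last exact: phi_gt0.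
exact: (integrable_affine _ _ continuous_phi norm_phi_le1).
Qed.

(** The denominator tends to 0 as [m] tends to [-oo], but the pointwise domination of [f] by [phi]
    passes to the averages, so the quotient is bounded uniformly in [m] and [c]. *)
Lemma gaussP_ratio_le1 f m c : continuous f -> (forall x, `|f x| <= phi x) ->
  `|gaussP f m c / gaussP phi m c| <= 1.
Proof.
move=> cf fphi; have P0 := gaussP_phi_gt0 m c.
rewrite normrM normfV (gtr0_norm P0) ler_pdivrMr// mul1r.
have f1 x : `|f x| <= 1 by rewrite (le_trans (fphi x))// ltW ?phi_lt1.
have fi := integrable_affine m c cf f1.
have phii := integrable_affine m c continuous_phi norm_phi_le1.
rewrite (le_trans (le_normr_Rintegral _ _))//; apply: le_EW => //.
have nf1 x : (`| `|f x| |) <= 1 by rewrite normr_id.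
apply: (@integrable_affine (fun x => `|f x|) 1) => // x.
by apply: cvg_norm; exact: cf.
Qed.

Lemma continuous_gaussP f c : continuous f -> (forall x, `|f x| <= phi x) ->
  continuous (fun m => gaussP f m c).
Proof.
move=> cf fphi.
apply: (@continuous_gaussT _ (fun m _ => f m) 1) => [|m]; first exact: cf.
by have := phi_lt1 m; have := fphi m; lra.
Qed.

(** As functions of the mean and standard deviation of the Gaussian argument given [(Y, G, Z)],
    [lnP] is the integrand of [Phi] and [ratio1] is the random variable [R(x, q)]. *)
Definition lnP m c : R := ln (gaussP phi m c).
Definition ratio1 m c : R := gaussP phi1 m c / gaussP phi m c.
Definition ratio2 m c : R := gaussP phi2 m c / gaussP phi m c.
Definition ratio3 m c : R := gaussP phi3 m c / gaussP phi m c.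

Lemma ratio1_gt0 m c : 0 < ratio1 m c.
Proof.
rewrite /ratio1 divr_gt0 ?gaussP_phi_gt0//.
apply: EW_gt0 => [|w]; last exact: phi1_gt0.
apply: (@integrable_affine _ 1 _ _ continuous_phi1) => x.
by rewrite (le_trans (norm_phi1 x))// ltW ?phi_lt1.
Qed.

Lemma norm_ratio1 m c : `|ratio1 m c| <= 1.
Proof. exact: gaussP_ratio_le1 continuous_phi1 norm_phi1. Qed.

Lemma norm_ratio2 m c : `|ratio2 m c| <= 1.
Proof. exact: gaussP_ratio_le1 continuous_phi2 norm_phi2. Qed.

Lemma norm_ratio3 m c : `|ratio3 m c| <= 1.
Proof. exact: gaussP_ratio_le1 continuous_phi3 norm_phi3. Qed.

Lemma continuous_ratio f c : continuous f -> (forall x, `|f x| <= phi x) ->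
  continuous (fun m => gaussP f m c / gaussP phi m c).
Proof.
move=> cf fphi m; apply: cvgM; first exact: continuous_gaussP.
apply: cvgV; first by rewrite gt_eqF// gaussP_phi_gt0.
by apply: (continuous_gaussP continuous_phi) => x; rewrite ger0_norm// ltW ?phi_gt0.
Qed.

Lemma continuous_ratio1 c : continuous (ratio1^~ c).
Proof. exact: continuous_ratio continuous_phi1 norm_phi1. Qed.

Lemma continuous_ratio2 c : continuous (ratio2^~ c).
Proof. exact: continuous_ratio continuous_phi2 norm_phi2. Qed.

Lemma continuous_ratio3 c : continuous (ratio3^~ c).
Proof. exact: continuous_ratio continuous_phi3 norm_phi3. Qed.

Lemma le_phi_le1 (f : R -> R) : (forall x, `|f x| <= phi x) ->
  forall x, `|f x| <= 1.
Proof. by move=> fphi x; rewrite (le_trans (fphi x))// ltW ?phi_lt1. Qed.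

Lemma gaussP_phi_curve (m m' c c' : R -> R) (t u v M : R) :
  t \in `]u, v[ ->
  (forall s, s \in `]u, v[ -> is_derive s 1 m (m' s)) ->
  (forall s, s \in `]u, v[ -> is_derive s 1 c (c' s)) ->
  (forall s, s \in `]u, v[ -> [/\ `|m' s| <= M, `|c' s| <= M & `|c s| <= M]) ->
  is_derive t 1 (fun s => gaussP phi (m s) (c s))
    (m' t * gaussP phi1 (m t) (c t) + c t * c' t * gaussP phi2 (m t) (c t)).
Proof.
exact: gaussP_curve is_derive_phi is_derive_phi1 continuous_phi2
  (le_phi_le1 norm_phi1) (le_phi_le1 norm_phi2).
Qed.

Lemma gaussP_phi1_curve (m m' c c' : R -> R) (t u v M : R) :
  t \in `]u, v[ ->
  (forall s, s \in `]u, v[ -> is_derive s 1 m (m' s)) ->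
  (forall s, s \in `]u, v[ -> is_derive s 1 c (c' s)) ->
  (forall s, s \in `]u, v[ -> [/\ `|m' s| <= M, `|c' s| <= M & `|c s| <= M]) ->
  is_derive t 1 (fun s => gaussP phi1 (m s) (c s))
    (m' t * gaussP phi2 (m t) (c t) + c t * c' t * gaussP phi3 (m t) (c t)).
Proof.
exact: gaussP_curve is_derive_phi1 is_derive_phi2 continuous_phi3
  (le_phi_le1 norm_phi2) (le_phi_le1 norm_phi3).
Qed.

Lemma is_derive_quotient (f g : R -> R) (x df dg : R) : g x != 0 ->
  is_derive x 1 f df -> is_derive x 1 g dg ->
  is_derive x 1 (fun y => f y / g y) ((df - f x / g x * dg) / g x).
Proof.
move=> gx0 dfx dgx; apply: is_derive_eq.
by rewrite /GRing.scale/=; field.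
Qed.

Lemma ratio1_curve (m m' c c' : R -> R) (t u v M : R) :
  t \in `]u, v[ ->
  (forall s, s \in `]u, v[ -> is_derive s 1 m (m' s)) ->
  (forall s, s \in `]u, v[ -> is_derive s 1 c (c' s)) ->
  (forall s, s \in `]u, v[ -> [/\ `|m' s| <= M, `|c' s| <= M & `|c s| <= M]) ->
  is_derive t 1 (fun s => ratio1 (m s) (c s))
    (m' t * (ratio2 (m t) (c t) - ratio1 (m t) (c t) ^+ 2) + c t * c' t *
    (ratio3 (m t) (c t) - ratio1 (m t) (c t) * ratio2 (m t) (c t))).
Proof.
move=> tuv dm dc bM.
have d0 := gaussP_phi_curve tuv dm dc bM.
have d1 := gaussP_phi1_curve tuv dm dc bM.
have P0 : gaussP phi (m t) (c t) != 0 by rewrite gt_eqF// gaussP_phi_gt0.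
have := @is_derive_quotient _ (fun s => gaussP phi (m s) (c s)) _ _ _ P0 d1 d0.
move=> /is_derive_eq; apply.
by rewrite /ratio1 /ratio2 /ratio3; field.
Qed.

Lemma is_derive_ratio1 m c :
  is_derive m 1 (ratio1^~ c) (ratio2 m c - ratio1 m c ^+ 2).
Proof.
have mI : m \in `]m - 1, m + 1[ by rewrite in_itv/= ltrBlDr !ltrDl ltr01.
have dc s : s \in `]m - 1, m + 1[ -> is_derive s 1 (fun=> c) 0.
  by move=> _; exact: is_derive_cst.
have di s : s \in `]m - 1, m + 1[ -> is_derive s 1 id (1 : R).
  by move=> _; exact: is_derive_id.
have b0 s : s \in `]m - 1, m + 1[ ->
    [/\ `|1 : R| <= `|c| + 1, `|0 : R| <= `|c| + 1 & `|c| <= `|c| + 1].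
  by rewrite normr1 normr0 lerDr lerDl ler01 normr_ge0 addr_ge0.
apply: is_derive_eq (ratio1_curve mI di dc b0) _.
by ring.
Qed.

Lemma is_derive_ratio2 m c :
  is_derive m 1 (ratio2^~ c) (ratio3 m c - ratio1 m c * ratio2 m c).
Proof.
have P0 : gaussP phi m c != 0 by rewrite gt_eqF// gaussP_phi_gt0.
have h0 := heat_smooth_cst is_derive_phi is_derive_phi1 continuous_phi2
  (le_phi_le1 norm_phi1) (le_phi_le1 norm_phi2).
have h1 := heat_smooth_cst is_derive_phi1 is_derive_phi2 continuous_phi3
  (le_phi_le1 norm_phi2) (le_phi_le1 norm_phi3).
have d2 : is_derive m 1 (fun m => gaussP phi2 m c) (gaussP phi3 m c).
  exact: is_derive_gaussT1 h1 m c 0.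
have d0 : is_derive m 1 (fun m => gaussP phi m c) (gaussP phi1 m c).
  exact: is_derive_gaussT0 h0 m c 0.
have := @is_derive_quotient _ (fun m => gaussP phi m c) _ _ _ P0 d2 d0.
move=> /is_derive_eq; apply.
by rewrite /ratio1 /ratio2 /ratio3; field.
Qed.

(** For [P = gaussP phi], the heat equation gives [c P'' / P] as the [c]-derivative of [ln P], so
    [kap] is [ratio2]. It exceeds the second derivative in [m] by [ratio1^2]; this nonlinear excess
    is the origin of the noise expectation B. *)
Lemma heat_smooth_lnP : heat_smooth 2 lnP ratio1
  (fun m c => ratio2 m c - ratio1 m c ^+ 2) ratio2.
Proof.
split.
- move=> m m' c c' t u v M tuv dm dc bM.
  have d0 := gaussP_phi_curve tuv dm dc bM.
  have P0 := gaussP_phi_gt0 (m t) (c t).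
  have dln := is_derive1_ln P0.
  have := @is_derive1_comp R (@ln R) (fun s => gaussP phi (m s) (c s)) t _ _ dln d0.
  move=> /is_derive_eq; apply.
  rewrite /ratio1 /ratio2; field.
  by rewrite gt_eqF.
- by move=> c m; exact: is_derive_ratio1.
- move=> c m; apply: cvgB; first exact: continuous_ratio2.
  by apply: cvgM; exact: continuous_ratio1.
- exact: continuous_ratio2.
- by move=> m c; rewrite (le_trans (norm_ratio1 m c))// ler1n.
- move=> m c; rewrite (le_trans (ler_normB _ _))// -[leRHS]/(1 + 1).
  by rewrite lerD ?norm_ratio2// normrX exprn_ile1 ?norm_ratio1 ?normr_ge0.
- by move=> m c; rewrite (le_trans (norm_ratio2 m c))// ler1n.
Qed.

Lemma norm_ratio1S m c : `|ratio2 m c - ratio1 m c ^+ 2| <= 2.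
Proof. exact: heat_bound2 heat_smooth_lnP m c. Qed.

Lemma norm_ratio2S m c : `|ratio3 m c - ratio1 m c * ratio2 m c| <= 2.
Proof.
rewrite (le_trans (ler_normB _ _))// -[leRHS]/(1 + 1) lerD ?norm_ratio3//.
rewrite normrM; apply: mulr_ile1 (normr_ge0 _) (normr_ge0 _) _ _.
  exact: norm_ratio1.
exact: norm_ratio2.
Qed.

(** Here [kap] is the [m]-derivative of [ratio2], the [kap] of [lnP], because the two
    differentiations commute. The constant 6 is [2 + 2 * 1 * 2], from the second derivative. *)
Lemma heat_smooth_ratio1 : heat_smooth 6 ratio1
  (fun m c => ratio2 m c - ratio1 m c ^+ 2)
  (fun m c => ratio3 m c - ratio1 m c * ratio2 m c -
     2 * ratio1 m c * (ratio2 m c - ratio1 m c ^+ 2))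
  (fun m c => ratio3 m c - ratio1 m c * ratio2 m c).
Proof.
have ck c : continuous (fun m => ratio3 m c - ratio1 m c * ratio2 m c).
  move=> m; apply: cvgB; first exact: continuous_ratio3.
  by apply: cvgM; [exact: continuous_ratio1|exact: continuous_ratio2].
split.
- by move=> m m' c c' t u v M tuv dm dc bM; exact: (ratio1_curve tuv dm dc bM).
- move=> c m; have d1 := is_derive_ratio1 m c; have d2 := is_derive_ratio2 m c.
  by apply: is_derive_eq; rewrite /GRing.scale/=; ring.
- move=> c m; apply: cvgB; first exact: ck.
  apply: cvgM.
    by apply: cvgM; [exact: cvg_cst|exact: continuous_ratio1].
  apply: cvgB; first exact: continuous_ratio2.
  by apply: cvgM; exact: continuous_ratio1.
- exact: ck.
- by move=> m c; rewrite (le_trans (norm_ratio1S m c))// ler_nat.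
- move=> m c; rewrite (le_trans (ler_normB _ _))//.
  have h1 := norm_ratio2S m c; have h2 := norm_ratio1S m c.
  have h3 := norm_ratio1 m c.
  have := ler_pM (normr_ge0 _) (normr_ge0 _) h3 h2.
  by rewrite -normrM -(mulrA 2) (normrM 2) (ger0_norm (ler0n _ 2)); lra.
- by move=> m c; rewrite (le_trans (norm_ratio2S m c))// ler_nat.
Qed.

Lemma heat_smooth_sqr (C : R) (k k1 k2 kap : R -> R -> R) :
  heat_smooth C k k1 k2 kap -> (forall m c, `|k m c| <= C) ->
  heat_smooth (4 * C ^+ 2) (fun m c => k m c ^+ 2)
    (fun m c => 2 * k m c * k1 m c)
    (fun m c => 2 * k1 m c ^+ 2 + 2 * k m c * k2 m c)
    (fun m c => 2 * k m c * kap m c).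
Proof.
move=> hk kC.
have C0 : 0 <= C by exact: le_trans (kC 0 0).
have ck c : continuous (k^~ c) by exact: (heat_continuous hk).
have c1 c : continuous (k1^~ c) by exact: (heat_continuous1 hk).
have c2 c : continuous (k2^~ c) by exact: (heat_continuous2 hk).
have ckap c : continuous (kap^~ c) by exact: (heat_continuous_kap hk).
have cprod (f g : R -> R) : continuous f -> continuous g ->
    continuous (fun x => 2 * f x * g x).
  move=> cf cg x; apply: cvgM; last exact: cg.
  by apply: cvgM; [exact: cvg_cst|exact: cf].
have bprod (f g : R) : `|f| <= C -> `|g| <= C -> `|2 * f * g| <= 2 * C ^+ 2.
  move=> fC gC; rewrite !normrM (ger0_norm (ler0n _ 2)) -mulrA expr2.
  by rewrite ler_wpM2l// ler_pM.
have C20 : 0 <= C ^+ 2 by exact: sqr_ge0.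
split.
- move=> m m' c c' t u v M tuv dm dc bM.
  have d := heat_curve hk tuv dm dc bM.
  by apply: is_derive_eq; rewrite /GRing.scale/=; ring.
- move=> c m; have d := heat_derive hk c m; have d1 := heat_derive1 hk c m.
  by apply: is_derive_eq; rewrite /GRing.scale/=; ring.
- move=> c m; apply: cvgD; last exact: cprod.
  apply: cvgM; first exact: cvg_cst.
  by apply: cvgM; exact: c1.
- by move=> c; exact: cprod.
- move=> m c; rewrite (le_trans (bprod _ _ (kC m c) (heat_bound1 hk m c)))//.
  by lra.
- move=> m c; rewrite (le_trans (ler_normD _ _))//.
  have := bprod _ _ (kC m c) (heat_bound2 hk m c).
  have := bprod _ _ (heat_bound1 hk m c) (heat_bound1 hk m c).
  by rewrite -mulrA -expr2; lra.
- move=> m c; rewrite (le_trans (bprod _ _ (kC m c) (heat_bound_kap hk m c)))//.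
  by lra.
Qed.

End sigmoid.

(** * The law of the spin *)

Section spin_average.
Context {R : realType}.

(** The image measure and the Bernoulli law are integrated for nonnegative functions, then applied
    to the positive and negative parts of [f]. *)
Lemma Rintegral_Rad (p : R) (f : R -> R) : 0 <= p <= 1 ->
  measurable_fun setT f ->
  \int[Rad p]_y f y = p * f 1 + (1 - p) * f (-1).
Proof.
move=> p01 mf.
have ge0_Rad (h : R -> R) : measurable_fun setT h -> (forall y, 0 <= h y) ->
    (\int[Rad p]_y (h y)%:E = (p * h 1 + (1 - p) * h (-1))%:E)%E.
  move=> mh h0.
  rewrite /Rad ge0_integral_distribution//; last exact/measurable_EFinP.
  by rewrite integral_bernoulli_prob// => b /=; rewrite lee_fin.
rewrite /Rintegral integralE.
have -> : (\int[Rad p]_y ((fun y => (f y)%:E)^\+ y) =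
    \int[Rad p]_y (Num.max (f y) 0)%:E)%E.
  by apply: eq_integral => y _; rewrite funeposE -EFin_max.
have -> : (\int[Rad p]_y ((fun y => (f y)%:E)^\- y) =
    \int[Rad p]_y (Num.max (- f y) 0)%:E)%E.
  by apply: eq_integral => y _; rewrite funenegE -EFinN -EFin_max.
rewrite !ge0_Rad//=.
- have maxE (a : R) : Num.max a 0 - Num.max (- a) 0 = a.
    have [a0|/ltW a0] := leP 0 a.
      have Na0 : - a <= 0 by rewrite oppr_le0.
      by rewrite (max_idPr Na0) subr0.
    have Na0 : 0 <= - a by rewrite oppr_ge0.
    by rewrite (max_idPl Na0) sub0r opprK.
  by rewrite -[in RHS](maxE (f 1)) -[in RHS](maxE (f (-1))); ring.
- by apply: measurable_maxr => //; exact: measurableT_comp.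
- by move=> y; rewrite le_max lexx orbT.
- exact: measurable_maxr.
- by move=> y; rewrite le_max lexx orbT.
Qed.

(* Since [phi (- s) = 1 - phi s], the law of [S = Y G] has density
   [2 phi (sqrt lambda s)] with respect to the Gaussian measure. *)
Lemma EYGZE (lambda A B : R) (h : R -> R -> R) :
  continuous (fun s => EW (h s)) ->
  (forall s, `|EW (h s)| <= A + B * `|s|) ->
  EYGZ lambda (fun y g z => h (y * g) z) =
  EW (fun g => 2 * phi (Num.sqrt lambda * g) * EW (h g)).
Proof.
move=> cK bK; set sg := Num.sqrt lambda; pose K s := EW (h s).
have cphi : continuous (fun g => phi (sg * g)).
  move=> g; apply: (@continuous_comp _ _ _ (fun g => sg * g) phi).
    by apply: cvgM; [exact: cvg_cst|exact: cvg_id].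
  exact: continuous_phi.
have cpK : continuous (fun g => phi (sg * g) * K g).
  by move=> g; apply: cvgM; [exact: cphi|exact: cK].
have mpK := continuous_measurable_fun cpK.
have bpK g : `|phi (sg * g) * K g| <= A + B * `|g|.
  rewrite normrM (le_trans _ (bK g))// ler_piMl//; exact: norm_phi_le1.
have i1 := integrable_gauss mpK bpK.
have i2 : (@gauss R).-integrable setT
    (EFin \o ((fun g => phi (sg * g) * K g) \o -%R)).
  apply: (@integrable_gauss _ _ A B) => [|g].
    exact: (measurableT_comp mpK).
  by rewrite -[`|g|]normrN; exact: bpK.
rewrite /EYGZ -/(EW _).
(* The two values of [Y] give two terms, exchanged by [g -> - g]; symmetry of the Gaussian makes
   them equal, whence the factor 2. *)
transitivity (EW (fun g => phi (sg * g) * K g + phi (sg * - g) * K (- g))).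
  congr EW; apply/funext => g.
  have cKg : continuous (fun y : R => K (y * g)).
    move=> y; apply: (@continuous_comp R R R (fun y => y * g) K).
      by apply: cvgM; [exact: cvg_id|exact: cvg_cst].
    exact: cK.
  have mKg := continuous_measurable_fun cKg.
  have p01 : 0 <= phi (sg * g) <= 1 by rewrite !ltW ?phi_gt0 ?phi_lt1.
  have := Rintegral_Rad p01 mKg => ->.
  by rewrite mulrN phiN mulN1r mul1r.
rewrite EWD//.
have := EW_sym cpK i1 i2 => ->.
rewrite -[RHS]/(EW (fun g => 2 * phi (sg * g) * K g)).
under [in RHS]eq_fun do rewrite -mulrA.
by rewrite EWZ//; ring.
Qed.

End spin_average.

(** * Derivatives along the sphere *)

Section spherical.
Context {R : realType}.

(** The cosine belonging to the sine [x]: the point [(x, coord x * t, coord x * coord t)] lies on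
    the unit sphere. *)
Definition coord (x : R) : R := Num.sqrt (1 - x ^+ 2).

Lemma sqr_lt1 (x : R) : -1 < x < 1 -> 0 < 1 - x ^+ 2.
Proof. by move=> /andP[x1 x2]; nra. Qed.

Lemma coord_gt0 (x : R) : -1 < x < 1 -> 0 < coord x.
Proof. by move=> /sqr_lt1; rewrite sqrtr_gt0. Qed.

Lemma sqr_coord (x : R) : -1 < x < 1 -> coord x ^+ 2 = 1 - x ^+ 2.
Proof. by move=> /sqr_lt1 /ltW h; rewrite sqr_sqrtr. Qed.

Lemma coord_le1 (x : R) : coord x <= 1.
Proof. by rewrite -[leRHS]sqrtr1 ler_wsqrtr// gerBl sqr_ge0. Qed.

Lemma is_derive_coord (x : R) : -1 < x < 1 ->
  is_derive x 1 coord (- (x / coord x)).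
Proof.
move=> x1; have s0 := sqr_lt1 x1; have c0 := coord_gt0 x1.
have ds := is_derive1_sqrt s0.
have dx : is_derive x 1 (fun x : R => 1 - x ^+ 2) (- (2 * x)).
  by apply: is_derive_eq; rewrite /GRing.scale/=; ring.
have := @is_derive1_comp R Num.sqrt (fun x : R => 1 - x ^+ 2) x _ _ ds dx.
move=> /is_derive_eq; apply.
by rewrite -/(coord x); field; rewrite gt_eqF.
Qed.

(** The derivative of [coord] blows up at -1 and 1, so the uniform bound needed along a curve is
    only local. The radius [rho] is halfway between [|x|] and 1. *)
Lemma coord_derivative_bound (x : R) : -1 < x < 1 ->
  exists u v d : R, [/\ x \in `]u, v[, 0 <= d &
    forall s, s \in `]u, v[ -> -1 < s < 1 /\ `|s / coord s| <= d].
Proof.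
move=> x1; pose rho := (1 + `|x|) / 2.
have xl : `|x| < 1 by rewrite ltr_norml.
have r0 : 0 <= rho by rewrite /rho; have := normr_ge0 x; lra.
have r1 : rho < 1 by rewrite /rho; lra.
have r11 : -1 < rho < 1 by lra.
exists (- rho), rho, (coord rho)^-1; split.
- by rewrite in_itv/= -ltr_norml /rho; have := normr_ge0 x; lra.
- by rewrite invr_ge0 ltW// coord_gt0.
- move=> s; rewrite in_itv/= => /andP[s1 s2].
  have s11 : -1 < s < 1 by lra.
  split=> //; rewrite normrM normfV (gtr0_norm (coord_gt0 s11)).
  rewrite -[leRHS]mul1r ler_pM ?invr_ge0 ?(ltW (coord_gt0 _))//.
    by rewrite ler_norml; lra.
  rewrite lef_pV2 ?posrE ?coord_gt0//.
  by rewrite /coord ler_wsqrtr// lerB//; nra.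
Qed.

Variable lambda : R.
Hypothesis lambda_gt0 : 0 < lambda.
Let sg := Num.sqrt lambda.

Let sg_gt0 : 0 < sg. Proof. by rewrite sqrtr_gt0. Qed.
Let sg2 : sg * sg = lambda. Proof. by rewrite -expr2 sqr_sqrtr// ltW. Qed.

(* [t] stands for [sqrt q]: the arguments of [gaussJ] then run over the sphere
   of radius [sqrt lambda] and depend smoothly on [t] near [0]. *)
Definition sphJ om k (x t : R) :=
  gaussJ om k (sg * x) (sg * (coord x * t)) (sg * (coord x * coord t)).

Section derivatives.
Variables (C : R) (k k1 k2 kap : R -> R -> R).
Hypothesis hk : heat_smooth C k k1 k2 kap.
Variables (W : R) (om : R -> R).
Hypothesis com : continuous om.
Hypothesis omW : forall g, `|om g| <= W.

Let C0 : 0 <= C. Proof. exact: le_trans (heat_bound1 hk 0 0). Qed.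
Let W0 : 0 <= W. Proof. exact: le_trans (omW 0). Qed.

(** The first-order term of the [x]-derivative, before integration by parts in the signal. *)
Definition sphJ1 (x t : R) := EW (fun g => om g *
  (g * gaussT k1 (sg * x * g) (sg * (coord x * t)) (sg * (coord x * coord t)))).

(** In [b b'] and [c c'] the factor [coord x] cancels against the denominator of its own derivative,
    leaving coefficients polynomial in [x] and [t]; hence bounds that do not degenerate at the
    boundary. *)
Lemma is_derive_sphJ_x (x t : R) : -1 < x < 1 -> -1 < t < 1 ->
  is_derive x 1 (fun x => sphJ om k x t)
    (sg * sphJ1 x t - lambda * x * t ^+ 2 * sphJ om k2 x t -
     lambda * x * (1 - t ^+ 2) * sphJ om kap x t).
Proof.
move=> x1 t1; have [u [v [d [xuv d0 bd]]]] := coord_derivative_bound x1.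
have t2 := sqr_coord t1; have x2 := sqr_coord x1; have cx := coord_gt0 x1.
have nt : `|t| <= 1 by rewrite ltW// ltr_norml.
have nct : `|coord t| <= 1 by rewrite ger0_norm ?coord_le1// ltW ?coord_gt0.
have da s : s \in `]u, v[ -> is_derive s 1 (fun x => sg * x) sg.
  by move=> _; apply: is_derive_eq; rewrite /GRing.scale/=; ring.
have db s : s \in `]u, v[ -> is_derive s 1 (fun x => sg * (coord x * t))
    (sg * (- (s / coord s) * t)).
  move=> /bd[s1 _]; have ds := is_derive_coord s1.
  by apply: is_derive_eq; rewrite /GRing.scale/=; ring.
have dc s : s \in `]u, v[ -> is_derive s 1 (fun x => sg * (coord x * coord t))
    (sg * (- (s / coord s) * coord t)).
  move=> /bd[s1 _]; have ds := is_derive_coord s1.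
  by apply: is_derive_eq; rewrite /GRing.scale/=; ring.
have sgn := gtr0_norm sg_gt0.
have bM s : s \in `]u, v[ -> [/\ `|sg| <= sg * (1 + d),
    `|sg * (- (s / coord s) * t)| <= sg * (1 + d),
    `|sg * (- (s / coord s) * coord t)| <= sg * (1 + d),
    `|sg * (coord s * t)| <= sg * (1 + d) &
    `|sg * (coord s * coord t)| <= sg * (1 + d)].
  move=> /bd[s1 sd].
  have bnd (y z : R) : `|y| <= 1 + d -> `|z| <= 1 ->
      `|sg * (y * z)| <= sg * (1 + d).
    move=> yd z1; rewrite !normrM sgn ler_wpM2l ?(ltW sg_gt0)//.
    by rewrite -[leRHS]mulr1 ler_pM.
  have cs : `|coord s| <= 1 + d.
    by rewrite ger0_norm ?(ltW (coord_gt0 _))// (le_trans (coord_le1 s))// lerDl.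
  have sd1 : `|- (s / coord s)| <= 1 + d by rewrite normrN (le_trans sd)// lerDr.
  split; [|exact: bnd..].
  by rewrite sgn ler_peMr ?(ltW sg_gt0)// lerDl.
have := is_derive_gaussJ hk com omW xuv da db dc bM.
move=> /is_derive_eq; apply; rewrite /sphJ1 /sphJ -sg2.
have -> : sg * (coord x * t) * (sg * (- (x / coord x) * t)) =
    - (sg * sg * x * t ^+ 2) by field; rewrite gt_eqF.
have -> : sg * (coord x * coord t) * (sg * (- (x / coord x) * coord t)) =
    - (sg * sg * x * coord t ^+ 2) by field; rewrite gt_eqF.
rewrite t2; move: (EW _) (gaussJ _ _ _ _ _) (gaussJ _ _ _ _ _) => e1 e2 e3.
by ring.
Qed.

(** Here [b b'] and [c c'] are opposite and both contain [t], which is kept in front so as to absorb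
    the derivative of [sqrt q] later. *)
Lemma is_derive_sphJ_t (x t : R) : -1 < x < 1 -> -1 < t < 1 ->
  is_derive t 1 (fun t => sphJ om k x t)
    (t * (lambda * (1 - x ^+ 2) * (sphJ om k2 x t - sphJ om kap x t))).
Proof.
move=> x1 t1; have [u [v [d [tuv d0 bd]]]] := coord_derivative_bound t1.
have t2 := sqr_coord t1; have x2 := sqr_coord x1; have ct := coord_gt0 t1.
have ncx : `|coord x| <= 1 by rewrite ger0_norm ?coord_le1// ltW ?coord_gt0.
have da s : s \in `]u, v[ -> is_derive s 1 (fun t => sg * x) 0.
  by move=> _; exact: is_derive_cst.
have db s : s \in `]u, v[ -> is_derive s 1 (fun t => sg * (coord x * t))
    (sg * (coord x * 1)).
  by move=> _; apply: is_derive_eq; rewrite /GRing.scale/=; ring.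
have dc s : s \in `]u, v[ -> is_derive s 1 (fun t => sg * (coord x * coord t))
    (sg * (coord x * - (s / coord s))).
  move=> /bd[s1 _]; have ds := is_derive_coord s1.
  by apply: is_derive_eq; rewrite /GRing.scale/=; ring.
have sgn := gtr0_norm sg_gt0.
have bM s : s \in `]u, v[ -> [/\ `|0 : R| <= sg * (1 + d),
    `|sg * (coord x * 1)| <= sg * (1 + d),
    `|sg * (coord x * - (s / coord s))| <= sg * (1 + d),
    `|sg * (coord x * s)| <= sg * (1 + d) &
    `|sg * (coord x * coord s)| <= sg * (1 + d)].
  move=> /bd[s1 sd].
  have bnd (z : R) : `|z| <= 1 + d ->
      `|sg * (coord x * z)| <= sg * (1 + d).
    move=> zd; rewrite !normrM sgn ler_wpM2l ?(ltW sg_gt0)//.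
    by rewrite -[leRHS]mul1r ler_pM.
  have cs : `|coord s| <= 1 + d.
    by rewrite ger0_norm ?(ltW (coord_gt0 _))// (le_trans (coord_le1 s))// lerDl.
  have sd1 : `|- (s / coord s)| <= 1 + d by rewrite normrN (le_trans sd)// lerDr.
  have ns : `|s| <= 1 + d by rewrite ler_norml; lra.
  have n1 : `|1 : R| <= 1 + d by rewrite normr1 lerDl.
  split; [|exact: bnd..].
  by rewrite normr0 mulr_ge0 ?(ltW sg_gt0)// addr_ge0.
have := is_derive_gaussJ hk com omW tuv da db dc bM.
move=> /is_derive_eq; apply; rewrite /sphJ -sg2.
have -> : sg * (coord x * t) * (sg * (coord x * 1)) =
    sg * sg * coord x ^+ 2 * t by ring.
have -> : sg * (coord x * coord t) * (sg * (coord x * - (t / coord t))) =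
    - (sg * sg * coord x ^+ 2 * t) by field; rewrite gt_eqF.
rewrite x2; move: (EW _) (gaussJ _ _ _ _ _) (gaussJ _ _ _ _ _) => e1 e2 e3.
by ring.
Qed.

Lemma sphJ1_bounded x t : `|sphJ1 x t| <= W * C * EW (fun g : R => `|g|).
Proof.
have c1 c : continuous (k1^~ c) by exact: (heat_continuous1 hk).
have b1 c m : `|k1 m c| <= C by exact: (heat_bound1 hk).
rewrite -[leRHS]add0r; apply: EW_norm_le => [|g].
  apply: measurable_funM; first exact: continuous_measurable_fun.
  apply: measurable_funM => //; apply: continuous_measurable_fun.
  by apply: (continuous_gaussT_scale (c1 _)); exact: b1.
rewrite add0r !normrM -(mulrA W) ler_pM ?mulr_ge0// (mulrC `|g|) ler_wpM2r//.
by apply: gaussT_bounded => [|m]; [exact: c1|exact: b1].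
Qed.

Lemma sphJ2_bounded x t : `|sphJ om k2 x t| <= W * C.
Proof.
apply: gaussJ_bounded => // [|m]; last exact: (heat_bound2 hk).
exact: (heat_continuous2 hk).
Qed.

Lemma sphJ_kap_bounded x t : `|sphJ om kap x t| <= W * C.
Proof.
apply: gaussJ_bounded => // [|m]; last exact: (heat_bound_kap hk).
exact: (heat_continuous_kap hk).
Qed.

End derivatives.
End spherical.

(** * The potential on the sphere and the expectations A and B *)

Section potential.
Context {R : realType}.
Variable lambda : R.
Hypothesis lambda_gt0 : 0 < lambda.
Let sg := Num.sqrt lambda.

Let sg_gt0 : 0 < sg. Proof. by rewrite sqrtr_gt0. Qed.
Let sg2 : sg * sg = lambda. Proof. by rewrite -expr2 sqr_sqrtr// ltW. Qed.

Definition density (g : R) : R := 2 * phi (sg * g).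
(** This weight has two roles: up to the factor [sqrt lambda] it is the derivative of [density], and
    it is [density] times the factor [phi(-sqrt lambda S)] of the first equation. *)
Definition tilted_density (g : R) : R := 2 * phi1 (sg * g).

Definition potential := sphJ lambda density lnP.
Definition overlap_signal := sphJ lambda tilted_density ratio1.
Definition overlap_noise := sphJ lambda density (fun m c => ratio1 m c ^+ 2).

Lemma continuous_scale (f : R -> R) (a : R) :
  continuous f -> continuous (fun g => a * f (sg * g)).
Proof.
move=> cf g; apply: cvgM; first exact: cvg_cst.
apply: (@continuous_comp R R R (fun g => sg * g) f); last exact: cf.
by apply: cvgM; [exact: cvg_cst|exact: cvg_id].
Qed.

Lemma continuous_density : continuous density.
Proof. exact: (@continuous_scale phi 2 (@continuous_phi R)). Qed.

Lemma continuous_tilted_density : continuous tilted_density.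
Proof. exact: (@continuous_scale phi1 2 (@continuous_phi1 R)). Qed.

Lemma density_bound g : `|density g| <= 2.
Proof. by rewrite normrM ger0_norm// ler_piMr// norm_phi_le1. Qed.

Lemma tilted_density_bound g : `|tilted_density g| <= 2.
Proof.
rewrite normrM ger0_norm// ler_piMr// (le_trans (norm_phi1 _))//.
by rewrite ltW// phi_lt1.
Qed.

Lemma density_ge0 g : 0 <= density g.
Proof. by rewrite mulr_ge0// ltW// phi_gt0. Qed.

Lemma tilted_density_ge0 g : 0 <= tilted_density g.
Proof. by rewrite mulr_ge0// ltW// phi1_gt0. Qed.

Lemma is_derive_density (g : R) : is_derive g 1 density (sg * tilted_density g).
Proof.
have ds : is_derive g 1 (fun g => sg * g) sg.
  by apply: is_derive_eq; rewrite /GRing.scale/=; ring.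
have d := @is_derive1_comp R phi (fun g => sg * g) g _ _
  (is_derive_phi (sg * g)) ds.
have := is_deriveM (is_derive_cst (2 : R) g (1 : R)) d.
move=> /is_derive_eq; apply.
by rewrite /tilted_density /GRing.scale/=; ring.
Qed.

Let hln := @heat_smooth_lnP R.

Lemma heat_smooth_ratio1_sqr : heat_smooth (4 * 6 ^+ 2 : R)
  (fun m c => ratio1 m c ^+ 2)
  (fun m c => 2 * ratio1 m c * (ratio2 m c - ratio1 m c ^+ 2))
  (fun m c => 2 * (ratio2 m c - ratio1 m c ^+ 2) ^+ 2 +
    2 * ratio1 m c * (ratio3 m c - ratio1 m c * ratio2 m c -
     2 * ratio1 m c * (ratio2 m c - ratio1 m c ^+ 2)))
  (fun m c => 2 * ratio1 m c * (ratio3 m c - ratio1 m c * ratio2 m c)).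
Proof.
apply: heat_smooth_sqr (heat_smooth_ratio1) _ => m c.
by rewrite (le_trans (norm_ratio1 m c))// ler1n.
Qed.

Let dln m c : R := ratio2 m c - ratio1 m c ^+ 2.

Lemma sphJ_ratio2 x t : sphJ lambda density ratio2 x t =
  sphJ lambda density dln x t + overlap_noise x t.
Proof.
have cd : forall c, continuous (dln^~ c) by exact: (heat_continuous2 hln).
have bd c m : `|dln m c| <= 2 by exact: (heat_bound2 hln).
have cs c : continuous (fun m : R => ratio1 m c ^+ 2).
  by move=> m; apply: cvgM; exact: continuous_ratio1.
have bs c m : `|ratio1 m c ^+ 2| <= (1 : R).
  by rewrite normrX exprn_ile1 ?norm_ratio1 ?normr_ge0.
rewrite /overlap_noise /sphJ /gaussJ -EWD; last 2 first.
- exact: (integrable_gaussJ _ _ continuous_density density_bound (cd _) (bd _)).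
- exact: (integrable_gaussJ _ _ continuous_density density_bound (cs _) (bs _)).
congr EW; apply/funext => g; rewrite -mulrDr; congr (_ * _).
rewrite /gaussT -EWD; last 2 first.
- apply: (@integrable_gauss_bounded _ _ 2) => [|z]; last exact: bd.
  apply: continuous_measurable_fun.
  by apply: (@continuous_affine _ (dln^~ _)); exact: cd.
- apply: (@integrable_gauss_bounded _ _ 1) => [|z]; last exact: bs.
  apply: continuous_measurable_fun.
  by apply: (@continuous_affine _ (fun m : R => ratio1 m _ ^+ 2)); exact: cs.
by congr EW; apply/funext => z; rewrite /dln subrK.
Qed.

Lemma is_derive_potential_x (x t : R) : -1 < x < 1 -> -1 < t < 1 ->
  is_derive x 1 (potential^~ t)
    (lambda * (overlap_signal x t - x * (1 - t ^+ 2) * overlap_noise x t)).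
Proof.
move=> x1 t1.
have := is_derive_sphJ_x lambda_gt0 hln continuous_density density_bound x1 t1.
move=> /is_derive_eq; apply.
rewrite sphJ_ratio2 /sphJ1 -/sg.
(* [gaussJ_Stein] asks for a common bound on the weight and on its derivative. *)
have bW g : `|density g| <= 2 + sg * 2.
  by rewrite (le_trans (density_bound g))// lerDl mulr_ge0// ltW.
have bW1 g : `|sg * tilted_density g| <= 2 + sg * 2.
  rewrite normrM (gtr0_norm sg_gt0) (@le_trans _ _ (sg * 2)) ?lerDr//.
  by rewrite ler_wpM2l ?(ltW sg_gt0)// tilted_density_bound.
have c1 : continuous (fun g => sg * tilted_density g).
  by move=> g; apply: cvgM; [exact: cvg_cst|exact: continuous_tilted_density].
rewrite (gaussJ_Stein hln continuous_density bW _ _ _ is_derive_density c1 bW1).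
have -> : gaussJ (fun g => sg * tilted_density g) ratio1 (sg * x)
    (sg * (coord x * t)) (sg * (coord x * coord t)) =
    sg * overlap_signal x t.
  rewrite /overlap_signal /sphJ /gaussJ -EWZ.
    by congr EW; apply/funext => g; rewrite mulrA.
  by apply: (integrable_gaussJ _ _ continuous_tilted_density
    tilted_density_bound (@continuous_ratio1 _ _)) => m; exact: norm_ratio1.
(* The average of [dln] has the coefficients [lambda x], [- lambda x t^2] and
   [- lambda x (1 - t^2)], whose sum is 0; [overlap_noise] comes with the last one only. *)
rewrite /dln -[gaussJ density _ _ _ _]/(sphJ lambda density dln x t).
rewrite -[in RHS]sg2 -sg2; ring.
Qed.

Lemma is_derive_potential_t (x t : R) : -1 < x < 1 -> -1 < t < 1 ->
  is_derive t 1 (potential x)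
    (t * (- (lambda * (1 - x ^+ 2) * overlap_noise x t))).
Proof.
move=> x1 t1.
have := is_derive_sphJ_t lambda_gt0 hln continuous_density density_bound x1 t1.
move=> /is_derive_eq; apply.
by rewrite sphJ_ratio2 -/dln; ring.
Qed.

(** Asking for a [t]-derivative of the form [t b] with [b] bounded makes the derivative in [q = t^2]
    equal to [b / 2], bounded down to [q = 0]. *)
Definition regular_overlap (L : R) (G : R -> R -> R) :=
  forall x t, -1 < x < 1 -> -1 < t < 1 -> [/\ 0 <= G x t <= L,
    exists2 d : R, is_derive x 1 (G^~ t) d & `|d| <= L &
    exists2 b : R, is_derive t 1 (G x) (t * b) & `|b| <= L].

Lemma regular_sphJ (C W : R) (k k1 k2 kap : R -> R -> R) (om : R -> R) :
  heat_smooth C k k1 k2 kap -> continuous om -> (forall g, `|om g| <= W) ->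
  (forall m c, 0 <= k m c) -> (forall m c, k m c <= 1) ->
  (forall g, 0 <= om g) ->
  exists2 L, 0 <= L & regular_overlap L (sphJ lambda om k).
Proof.
move=> hk com omW k0 kle1 om0.
have C0 : 0 <= C by exact: le_trans (heat_bound1 hk 0 0).
have W0 : 0 <= W by exact: le_trans (omW 0).
have N0 : 0 <= EW (fun g : R => `|g|) by exact: EW_ge0.
have WC0 : 0 <= W * C by rewrite mulr_ge0.
have l0 := ltW lambda_gt0.
(* The three summands serve, in order, the value, the first-order term in [x], and the two
   second-order terms of either derivative. *)
exists (W + sg * (W * C * EW (fun g : R => `|g|)) + lambda * (W * C) * 2).
  by rewrite !addr_ge0// !mulr_ge0// ltW.
have P1 : 0 <= sg * (W * C * EW (fun g : R => `|g|)) by rewrite !mulr_ge0// ltW.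
have P2 : 0 <= lambda * (W * C) by rewrite mulr_ge0.
move=> x t x1 t1; split.
- apply/andP; split.
    apply: EW_ge0 => g; rewrite mulr_ge0//; exact: EW_ge0.
  have kn m c : `|k m c| <= 1 by rewrite ger0_norm.
  apply: (@le_trans _ _ (W * 1)); last by rewrite mulr1; lra.
  rewrite (le_trans (ler_norm _))// gaussJ_bounded//.
  exact: (heat_continuous hk).
- eexists; first exact: (is_derive_sphJ_x lambda_gt0 hk com omW x1 t1).
  have t20 : 0 <= t ^+ 2 by exact: sqr_ge0.
  have t21 : 0 <= 1 - t ^+ 2 by rewrite ltW ?sqr_lt1.
  have h1 : `|sg * sphJ1 lambda k1 om x t| <=
      sg * (W * C * EW (fun g : R => `|g|)).
    rewrite normrM (gtr0_norm sg_gt0) ler_wpM2l ?(ltW sg_gt0)//.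
    exact: (sphJ1_bounded lambda hk com omW).
  have bb (a y : R) : 0 <= a <= 1 -> `|y| <= W * C ->
      `|lambda * x * a * y| <= lambda * (W * C).
    move=> /andP[a0 a1] yC; rewrite !normrM (gtr0_norm lambda_gt0) -!mulrA.
    rewrite ler_wpM2l// -[leRHS]mul1r ler_pM ?mulr_ge0//.
      by rewrite ltW// ltr_norml.
    by rewrite -[leRHS]mul1r ler_pM// ger0_norm.
  have h2 : `|lambda * x * t ^+ 2 * sphJ lambda om k2 x t| <= lambda * (W * C).
    apply: bb; last exact: (sphJ2_bounded lambda hk com omW).
    by rewrite t20/=; lra.
  have h3 : `|lambda * x * (1 - t ^+ 2) * sphJ lambda om kap x t| <=
      lambda * (W * C).
    apply: bb; last exact: (sphJ_kap_bounded lambda hk com omW).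
    by rewrite t21/=; lra.
  move: h1 h2 h3; move: (sg * sphJ1 _ _ _ _ _) (_ * sphJ _ _ k2 _ _).
  move: (_ * sphJ _ _ kap _ _) => e3 e1 e2 h1 h2 h3.
  have := ler_normB (e1 - e2) e3; have := ler_normB e1 e2; lra.
- eexists; first exact: (is_derive_sphJ_t lambda_gt0 hk com omW x1 t1).
  have x20 : 0 <= 1 - x ^+ 2 <= 1.
    by have := sqr_lt1 x1; have := sqr_ge0 x; lra.
  have [x21 x22] := andP x20.
  have h2 := sphJ2_bounded lambda hk com omW x t.
  have h3 := sphJ_kap_bounded lambda hk com omW x t.
  move: h2 h3; move: (sphJ _ _ k2 _ _) (sphJ _ _ kap _ _) => e2 e3 h2 h3.
  rewrite 2!normrM (gtr0_norm lambda_gt0) (ger0_norm x21).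
  apply: (@le_trans _ _ (lambda * (W * C) * 2)); last by lra.
  rewrite -!mulrA ler_wpM2l// -[leRHS]mul1r ler_pM//.
  by rewrite (le_trans (ler_normB _ _))//; lra.
Qed.

Lemma regular_overlaps : exists2 L, 0 <= L &
  regular_overlap L overlap_signal /\ regular_overlap L overlap_noise.
Proof.
have r0 m c : 0 <= ratio1 m c :> R by rewrite ltW ?ratio1_gt0.
have r1 m c : ratio1 m c <= 1 :> R.
  by rewrite (le_trans (ler_norm _))// norm_ratio1.
have [L1 L10 h1] := regular_sphJ (@heat_smooth_ratio1 R)
  continuous_tilted_density tilted_density_bound r0 r1 tilted_density_ge0.
have s0 m c : 0 <= ratio1 m c ^+ 2 :> R by exact: sqr_ge0.
have s1 m c : ratio1 m c ^+ 2 <= 1 :> R by rewrite exprn_ile1.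
have [L2 L20 h2] := regular_sphJ heat_smooth_ratio1_sqr
  continuous_density density_bound s0 s1 density_ge0.
exists (L1 + L2); first by rewrite addr_ge0.
split=> x t x1 t1.
- have [h [d hd dL] [b hb bL]] := h1 x t x1 t1; split.
  + by move: h => /andP[-> /le_trans]; apply; rewrite lerDl.
  + by exists d => //; rewrite (le_trans dL)// lerDl.
  + by exists b => //; rewrite (le_trans bL)// lerDl.
- have [h [d hd dL] [b hb bL]] := h2 x t x1 t1; split.
  + by move: h => /andP[-> /le_trans]; apply; rewrite lerDr.
  + by exists d => //; rewrite (le_trans dL)// lerDr.
  + by exists b => //; rewrite (le_trans bL)// lerDr.
Qed.

End potential.

(** * From derivatives in [x] and [t] to Lipschitz bounds in [x] and [q] *)

Section mean_value.
Context {R : realType}.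

Lemma derive_lipschitz (f : R -> R) (L x y : R) : x <= y ->
  {in `[x, y]%classic, continuous f} ->
  (forall z : R, x < z -> z < y -> exists2 d : R, is_derive z 1 f d & `|d| <= L) ->
  `|f y - f x| <= L * (y - x).
Proof.
rewrite le_eqVlt => /predU1P[->|xy cf df]; first by rewrite !subrr normr0 mulr0.
have df1 z : z \in `]x, y[%R -> is_derive z 1 f (derive1 f z).
  rewrite in_itv/= => /andP[xz zy]; have [d hd _] := df z xz zy.
  by apply: DeriveDef; [have [] := hd|rewrite derive1E].
have [z zxy ->] := MVT xy df1 (continuous_in_subspaceT cf).
have yx0 : 0 < y - x by rewrite subr_gt0.
rewrite normrM (gtr0_norm yx0) ler_wpM2r ?(ltW yx0)//.
move: zxy; rewrite in_itv/= => /andP[xz zy]; have [d hd dL] := df z xz zy.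
by have [_ dE] := hd; rewrite derive1E dE.
Qed.

Lemma is_derive_continuous_at (f : R -> R) (x d : R) :
  is_derive x 1 f d -> {for x, continuous f}.
Proof.
by move=> [df _]; apply: differentiable_continuous; exact/derivable1_diffP.
Qed.

Lemma sqrt_itv (q : R) : 0 <= q < 1 -> -1 < Num.sqrt q < 1.
Proof.
move=> /andP[q0 q1]; rewrite (lt_le_trans _ (sqrtr_ge0 q))/=; last first.
  by rewrite oppr_lt0.
by rewrite -[ltRHS]sqrtr1 ltr_sqrt.
Qed.

Lemma continuous_comp_sqrt (f : R -> R) (q : R) :
  {for Num.sqrt q, continuous f} -> {for q, continuous (f \o Num.sqrt)}.
Proof.
by move=> cf; apply: continuous_comp => //; exact: sqrt_continuous.
Qed.

(** The factor [sqrt q] in the derivative of [f] cancels the [1 / (2 sqrt q)] of the chain rule. *)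
Lemma is_derive_comp_sqrt (f : R -> R) (q b : R) : 0 < q ->
  is_derive (Num.sqrt q) 1 f (Num.sqrt q * b) ->
  is_derive q 1 (fun q => f (Num.sqrt q)) (b / 2).
Proof.
move=> q0 df; have ds := is_derive1_sqrt q0.
have := @is_derive1_comp R f Num.sqrt q _ _ df ds.
move=> /is_derive_eq; apply.
have s0 : Num.sqrt q != 0 by rewrite gt_eqF// sqrtr_gt0.
by field.
Qed.

Lemma regular_lipschitz (L : R) (G : R -> R -> R) : 0 <= L ->
  regular_overlap L G -> forall x x' q q' : R,
  -1 < x < 1 -> -1 < x' < 1 -> 0 <= q < 1 -> 0 <= q' < 1 ->
  `|G x (Num.sqrt q) - G x' (Num.sqrt q')| <= L * (`|x - x'| + `|q - q'|).
Proof.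
move=> L0 hG.
have lipx (x x' t : R) : x <= x' -> -1 < x < 1 -> -1 < x' < 1 -> -1 < t < 1 ->
    `|G x' t - G x t| <= L * (x' - x).
  move=> xx' /andP[x1 _] /andP[_ x2] t1.
  apply: (@derive_lipschitz (G^~ t)) => // [z|z xz zx].
    rewrite inE/= in_itv/= => /andP[xz zx].
    have z1 : -1 < z < 1 by lra.
    have [_ [d hd _] _] := hG z t z1 t1.
    exact: is_derive_continuous_at hd.
  have z1 : -1 < z < 1 by lra.
  by have [_ [d hd dL] _] := hG z t z1 t1; exists d.
have lipq (x q q' : R) : q <= q' -> -1 < x < 1 -> 0 <= q < 1 -> 0 <= q' < 1 ->
    `|G x (Num.sqrt q') - G x (Num.sqrt q)| <= L * (q' - q).
  move=> qq' x1 /andP[q0 _] /andP[_ q1].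
  (* At [q = 0] the square root is only continuous, which suffices for an endpoint in the mean value
     theorem. *)
  apply: (@derive_lipschitz (fun q => G x (Num.sqrt q))) => // [z|z qz zq].
    rewrite inE/= in_itv/= => /andP[qz zq].
    have z1 : 0 <= z < 1 by lra.
    have [_ _ [b hb _]] := hG x _ x1 (sqrt_itv z1).
    exact/continuous_comp_sqrt/(is_derive_continuous_at hb).
  have z0 : 0 < z by lra.
  have z1 : 0 <= z < 1 by lra.
  have [_ _ [b hb bL]] := hG x _ x1 (sqrt_itv z1).
  exists (b / 2); first exact: is_derive_comp_sqrt hb.
  rewrite normrM normfV (ger0_norm (ler0n _ 2)).
  by have := normr_ge0 b; lra.
move=> x x' q q' x1 x1' q1 q1'.
have -> : G x (Num.sqrt q) - G x' (Num.sqrt q') =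
    (G x (Num.sqrt q) - G x' (Num.sqrt q)) +
    (G x' (Num.sqrt q) - G x' (Num.sqrt q')) by ring.
rewrite (le_trans (ler_normD _ _))// mulrDr lerD//.
- have [xx'|/ltW xx'] := leP x x'.
    rewrite distrC (distrC x) (ger0_norm (_ : 0 <= x' - x)) ?subr_ge0//.
    exact/lipx/sqrt_itv.
  rewrite (ger0_norm (_ : 0 <= x - x')) ?subr_ge0//.
  exact/lipx/sqrt_itv.
- have [qq'|/ltW qq'] := leP q q'.
    rewrite distrC (distrC q) (ger0_norm (_ : 0 <= q' - q)) ?subr_ge0//.
    exact: lipq.
  rewrite (ger0_norm (_ : 0 <= q - q')) ?subr_ge0//.
  exact: lipq.
Qed.

End mean_value.

(** * The expectations of the statement as averages on the sphere *)

Section identification.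
Context {R : realType}.
Variable lambda : R.
Hypothesis lambda_gt0 : 0 < lambda.
Let sg := Num.sqrt lambda.

(** This is where [t = sqrt q] enters: [coord (sqrt q)] is [sqrt (1 - q)], and the roots of products
    in [V] split since [1 - x^2] is nonnegative. *)
Lemma V_scale (x q y g z w : R) : -1 < x < 1 -> 0 <= q < 1 ->
  sg * V x q y g z w = sg * x * (y * g) +
    sg * (coord x * Num.sqrt q) * z +
    sg * (coord x * coord (Num.sqrt q)) * w.
Proof.
move=> x1 /andP[q0 q1]; have x0 := sqr_lt1 x1.
by rewrite /V /coord sqr_sqrtr// !sqrtrM ?(ltW x0)//; ring.
Qed.

Lemma EYGZ_heat (C : R) (k k1 k2 kap : R -> R -> R) (a b c : R) :
  heat_smooth C k k1 k2 kap ->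
  EYGZ lambda (fun y g z => k (a * (y * g) + b * z) c) =
  gaussJ (density lambda) k a b c.
Proof.
move=> hk.
have := @EYGZE R lambda (`|k 0 c| + C * `|b| * EW (fun z : R => `|z|)) (C * `|a|)
  (fun s z => k (a * s + b * z) c).
apply.
- move=> s; apply: (@continuous_comp R R R (fun s => a * s)
    (fun m => gaussT k m b c)).
    by apply: cvgM; [exact: cvg_cst|exact: cvg_id].
  exact: (is_derive_continuous (fun m => is_derive_gaussT0 hk m b c)).
- move=> s; rewrite (le_trans (gaussT_growth hk _ _ _))// normrM; lra.
Qed.

Lemma PhiE (alpha x q : R) : -1 < x < 1 -> 0 <= q < 1 ->
  Phi lambda alpha x q = alpha * potential lambda x (Num.sqrt q)
    + 1 / 2 * (q / (1 - q)) + 1 / 2 * ln ((1 - x ^+ 2) * (1 - q)).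
Proof.
move=> x1 q1; rewrite /Phi; congr (_ * _ + _ + _).
rewrite /potential /sphJ -(EYGZ_heat _ _ _ heat_smooth_lnP).
congr EYGZ; apply/funext => y; apply/funext => g; apply/funext => z.
rewrite /lnP gaussPE; congr ln; congr EW; apply/funext => w.
by rewrite /u lnK ?posrE ?phi_gt0// -/sg V_scale.
Qed.

Lemma RratioE (x q y g z : R) : -1 < x < 1 -> 0 <= q < 1 ->
  Rratio lambda x q y g z =
  ratio1 (sg * x * (y * g) + sg * (coord x * Num.sqrt q) * z)
    (sg * (coord x * coord (Num.sqrt q))).
Proof.
move=> x1 q1; rewrite /Rratio derive1_phi -/sg.
have EW_V (f : R -> R) : EW (fun w => f (sg * V x q y g z w)) =
    gaussP f (sg * x * (y * g) + sg * (coord x * Num.sqrt q) * z)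
      (sg * (coord x * coord (Num.sqrt q))).
  by rewrite gaussPE; congr EW; apply/funext => w; rewrite V_scale.
by rewrite !EW_V.
Qed.

Lemma overlap_noiseE (x q : R) : -1 < x < 1 -> 0 <= q < 1 ->
  EYGZ lambda (fun y g z => Rratio lambda x q y g z ^+ 2) =
  overlap_noise lambda x (Num.sqrt q).
Proof.
move=> x1 q1.
rewrite /overlap_noise /sphJ -(EYGZ_heat _ _ _ heat_smooth_ratio1_sqr).
apply: congr1; apply/funext => y; apply/funext => g; apply/funext => z.
exact: (congr1 (fun r => r ^+ 2) (RratioE y g z x1 q1)).
Qed.

Lemma overlap_signalE (x q : R) : -1 < x < 1 -> 0 <= q < 1 ->
  EYGZ lambda (fun y g z =>
    phi (- sg * y * g) * Rratio lambda x q y g z) =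
  overlap_signal lambda x (Num.sqrt q).
Proof.
move=> x1 q1.
set a := sg * x; set b := sg * (coord x * Num.sqrt q).
set c := sg * (coord x * coord (Num.sqrt q)).
pose h s z := phi (- (sg * s)) * ratio1 (a * s + b * z) c.
have hE s : EW (h s) = phi (- (sg * s)) * gaussT ratio1 (a * s) b c.
  rewrite /h EWZ//.
  apply: (@integrable_gauss_bounded _ _ 1) => [|z]; last exact: norm_ratio1.
  apply: continuous_measurable_fun.
  by apply: (@continuous_affine _ (ratio1^~ c)); exact: continuous_ratio1.
transitivity (EYGZ lambda (fun y g z => h (y * g) z)).
  apply: congr1; apply/funext => y; apply/funext => g; apply/funext => z.
  rewrite (RratioE y g z x1 q1); congr (phi _ * _).
  by rewrite -mulrA mulNr.
rewrite (@EYGZE _ _ 1 0).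
(* The factor [phi (- s) = 1 - phi s] multiplies the density [2 phi s] into [2 phi1 s]. *)
- congr EW; apply/funext => g; rewrite hE /tilted_density phiN /phi1 -/sg.
  by ring.
- under eq_fun do rewrite hE.
  move=> s; apply: cvgM.
    apply: (@continuous_comp R R R (fun s => - (sg * s)) phi).
      by apply: cvgN; apply: cvgM; [exact: cvg_cst|exact: cvg_id].
    exact: continuous_phi.
  by apply: (continuous_gaussT_scale (@continuous_ratio1 _ _)) => m;
    exact: norm_ratio1.
- move=> s; rewrite mul0r addr0 hE normrM mulr_ile1// ?norm_phi_le1//.
  by apply: gaussT_bounded => [|m]; [exact: continuous_ratio1|exact: norm_ratio1].
Qed.

End identification.

(** * Saddle points and small coupling *)

Section saddle_point.
Context {R : realType}.

(** Two slices suffice: for [x != xs], [infq F x <= F x qs < F xs qs = infq F xs]. So the infimum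
    over [q] is never computed away from [xs]. *)
Lemma uniquely_achievedP (F : R -> R -> R) (xs qs : R) :
  0 <= xs < 1 -> 0 <= qs < 1 ->
  (forall q, 0 <= q < 1 -> q != qs -> F xs qs < F xs q) ->
  (forall x, -1 < x < 1 -> x != xs -> F x qs < F xs qs) ->
  uniquely_achieved F xs qs.
Proof.
move=> xs01 qs01 Fq Fx.
have infle x : (infq F x <= (F x qs)%:E)%E.
  by apply: ereal_inf_lbound; exists qs => //=; rewrite in_itv.
have infE : infq F xs = (F xs qs)%:E.
  apply/eqP; rewrite eq_le infle/=; apply: le_ereal_inf_tmp => _ [q /= + <-].
  rewrite in_itv/= => q01; rewrite lee_fin.
  by have [->//|/(Fq _ q01)/ltW] := eqVneq q qs.
have xs11 : -1 < xs < 1 by lra.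
have supE : supinf F = (F xs qs)%:E.
  apply/eqP; rewrite eq_le; apply/andP; split; last first.
    by rewrite -infE; apply: ereal_sup_ubound; exists xs => //=; rewrite in_itv.
  apply: ge_ereal_sup => _ [x /= + <-]; rewrite in_itv/= => x11.
  rewrite (le_trans (infle x))// lee_fin.
  by have [->//|/(Fx _ x11)/ltW] := eqVneq x xs.
split; apply/seteqP; split.
- move=> x /= [x01 xE]; apply/eqP; apply: contraT => xxs.
  have x11 : -1 < x < 1 by lra.
  have := infle x; rewrite xE supE lee_fin.
  by rewrite leNgt Fx.
- by move=> _ ->; split => //; rewrite infE supE.
- move=> q /= [q01 qE]; apply/eqP; apply: contraT => qqs.
  by have := Fq q q01 qqs; rewrite -lte_fin qE infE ltxx.
- by move=> _ ->; split => //; rewrite infE.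
Qed.

Lemma derive_lt (f df : R -> R) (x y : R) : x < y ->
  {in `[x, y]%classic, continuous f} ->
  (forall z : R, x < z -> z < y -> is_derive z 1 f (df z)) ->
  (forall z, x < z -> z < y -> 0 < df z) -> f x < f y.
Proof.
move=> xy cf dfz df0; rewrite -subr_gt0.
have df1 z : z \in `]x, y[%R -> is_derive z 1 f (df z).
  by rewrite in_itv/= => /andP[xz zy]; exact: dfz.
have [z zxy ->] := MVT xy df1 (continuous_in_subspaceT cf).
rewrite mulr_gt0 ?subr_gt0//.
by move: zxy; rewrite in_itv/= => /andP[]; exact: df0.
Qed.

Lemma derive_gt (f df : R -> R) (x y : R) : x < y ->
  {in `[x, y]%classic, continuous f} ->
  (forall z : R, x < z -> z < y -> is_derive z 1 f (df z)) ->
  (forall z, x < z -> z < y -> df z < 0) -> f y < f x.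
Proof.
move=> xy cf dfz df0; rewrite -subr_lt0.
have df1 z : z \in `]x, y[%R -> is_derive z 1 f (df z).
  by rewrite in_itv/= => /andP[xz zy]; exact: dfz.
have [z zxy ->] := MVT xy df1 (continuous_in_subspaceT cf).
rewrite pmulr_llt0 ?subr_gt0//.
by move: zxy; rewrite in_itv/= => /andP[]; exact: df0.
Qed.

Lemma lipschitz_within_continuous (f : R -> R) (K a b : R) : 0 <= K ->
  (forall x y, a <= x <= b -> a <= y <= b -> `|f x - f y| <= K * `|x - y|) ->
  {within `[a, b], continuous f}.
Proof.
move=> K0 fK; apply/subspace_continuousP => x /=; rewrite in_itv/= => axb.
apply/cvgrPdist_le => e e0; rewrite near_withinE.
near=> y => /=; rewrite in_itv/= => ayb.
rewrite (le_trans (fK _ _ axb ayb))//.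
have K1 : 0 < K + 1 by rewrite ltr_wpDl.
rewrite (@le_trans _ _ ((K + 1) * `|x - y|))//.
  by rewrite ler_wpM2r// lerDl.
have eK : 0 < e / (K + 1) by rewrite divr_gt0.
suff : `|x - y| <= e / (K + 1) by rewrite ler_pdivlMr// mulrC.
apply: ltW; suff : ball x (e / (K + 1)) y by [].
by near: y; apply: nbhsx_ballx; rewrite divr_gt0// ltr_wpDl.
Unshelve. all: end_near. Qed.

(* The intermediate value theorem gives [q = T x q] for each [x], with [q]
   Lipschitz in [x], and then [x = S x q]. *)
Lemma square_contraction_fixpoint (S T : R -> R -> R) :
  (forall x q, 0 <= x <= 2^-1 -> 0 <= q <= 2^-1 ->
    0 <= S x q <= 2^-1 /\ 0 <= T x q <= 2^-1) ->
  (forall x q x' q', 0 <= x <= 2^-1 -> 0 <= q <= 2^-1 ->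
    0 <= x' <= 2^-1 -> 0 <= q' <= 2^-1 ->
    `|S x q - S x' q'| <= 4^-1 * (`|x - x'| + `|q - q'|) /\
    `|T x q - T x' q'| <= 4^-1 * (`|x - x'| + `|q - q'|)) ->
  exists x q, [/\ 0 <= x <= 2^-1, 0 <= q <= 2^-1, S x q = x & T x q = q].
Proof.
move=> ST01 STlip.
have h00 : 0 <= (0 : R) <= 2^-1 by lra.
have h11 : 0 <= (2^-1 : R) <= 2^-1 by lra.
have root (f : R -> R) : {within `[0, 2^-1], continuous f} ->
    f 0 <= 0 -> 0 <= f 2^-1 -> exists2 c : R, 0 <= c <= 2^-1 & f c = 0.
  move=> cf f0 f1.
  have half0 : 0 <= 2^-1 :> R by lra.
  have [|c + fc] := @IVT R f 0 2^-1 0 half0 cf.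
  - by rewrite ge_min f0 le_max f1 orbT.
  - by rewrite in_itv/= => cI; exists c.
(* The hypothesis on [x] sits under the existential so that [choice] yields a total function; the
   value 0 outside the interval is a dummy. *)
have exq x : exists q, 0 <= x <= 2^-1 -> 0 <= q <= 2^-1 /\ T x q = q.
  have [x01|_] := boolP (0 <= x <= 2^-1); last by exists 0.
  have [|||q qI qE] := root (fun q => q - T x q).
  - apply: (@lipschitz_within_continuous _ 2) => // q q' qI qI'.
    have -> : q - T x q - (q' - T x q') = (q - q') - (T x q - T x q') by ring.
    rewrite (le_trans (ler_normB _ _))//.
    have [_] := STlip x q x q' x01 qI x01 qI'.
    rewrite subrr normr0; have := normr_ge0 (q - q'); lra.
  - by have [_] := ST01 x 0 x01 h00; lra.
  - by have [_] := ST01 x 2^-1 x01 h11; lra.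
  by exists q => _; split => //; lra.
have [Q hQ] := choice exq.
(* From [|Q x - Q x'| <= (|x - x'| + |Q x - Q x'|) / 4] the last term is absorbed, giving even the
   constant [1/3]. *)
have Qlip x x' : 0 <= x <= 2^-1 -> 0 <= x' <= 2^-1 ->
    `|Q x - Q x'| <= `|x - x'|.
  move=> xI xI'; have [qI qE] := hQ x xI; have [qI' qE'] := hQ x' xI'.
  have [_] := STlip x (Q x) x' (Q x') xI qI xI' qI'.
  rewrite qE qE'; have := normr_ge0 (x - x'); lra.
have [|||x xI xE] := root (fun x => x - S x (Q x)).
- apply: (@lipschitz_within_continuous _ 2) => // x x' xI xI'.
  have [qI qE] := hQ x xI; have [qI' qE'] := hQ x' xI'.
  have -> : x - S x (Q x) - (x' - S x' (Q x')) =
    (x - x') - (S x (Q x) - S x' (Q x')) by ring.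
  rewrite (le_trans (ler_normB _ _))//.
  have [+ _] := STlip x (Q x) x' (Q x') xI qI xI' qI'.
  have := Qlip x x' xI xI'; have := normr_ge0 (x - x'); lra.
- by have [qI _] := hQ 0 h00; have [+ _] := ST01 0 (Q 0) h00 qI; lra.
- by have [qI _] := hQ 2^-1 h11; have [+ _] := ST01 2^-1 (Q 2^-1) h11 qI; lra.
by have [qI qE] := hQ x xI; exists x, (Q x); split => //; lra.
Qed.

(** The constant 3 is 2 from varying [f], of Lipschitz constant 2, plus 1 from varying [h] with [f]
    at most 1. *)
Lemma scaled_product_lipschitz (K : R) (f h : R -> R -> R)
    (x q x' q' : R) :
  0 <= f x q <= 1 -> 0 <= f x' q' <= 1 ->
  0 <= h x q <= K -> 0 <= h x' q' <= K ->
  `|f x q - f x' q'| <= 2 * (`|x - x'| + `|q - q'|) ->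
  `|h x q - h x' q'| <= K * (`|x - x'| + `|q - q'|) ->
  `|f x q * h x q - f x' q' * h x' q'| <= 3 * K * (`|x - x'| + `|q - q'|).
Proof.
move=> /andP[f0 f1] /andP[f0' f1'] /andP[h0 h1] /andP[h0' h1'] df dh.
have -> : f x q * h x q - f x' q' * h x' q' =
  (f x q - f x' q') * h x q + f x' q' * (h x q - h x' q') by ring.
rewrite (le_trans (ler_normD _ _))// !normrM (ger0_norm h0) (ger0_norm f0').
have p1 := ler_pM (normr_ge0 _) h0 df h1.
have p2 := ler_pM f0' (normr_ge0 _) f1' dh.
lra.
Qed.

End saddle_point.

(** * Entropic terms against a small Lipschitz perturbation *)

Section small_coupling.
Context {R : realType}.

(** The difference quotient is [(1 + x y) / ((1 - x^2) (1 - y^2))]. Numerator minus denominator is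
    half of [(x + y)^2 + x^2 (1 - y^2) + y^2 (1 - x^2)]. *)
Lemma odds_expanding (x y : R) : -1 < x < 1 -> -1 < y < 1 -> x < y ->
  y - x <= y / (1 - y ^+ 2) - x / (1 - x ^+ 2).
Proof.
move=> x1 y1 xy; have hx := sqr_lt1 x1; have hy := sqr_lt1 y1.
have -> : y / (1 - y ^+ 2) - x / (1 - x ^+ 2) =
    (y - x) * (1 + x * y) / ((1 - x ^+ 2) * (1 - y ^+ 2)).
  by field; rewrite !gt_eqF.
rewrite ler_pdivlMr ?mulr_gt0// ler_pM2l ?subr_gt0//.
have h1 := sqr_ge0 (x + y).
have h2 : 0 <= x ^+ 2 * (1 - y ^+ 2) by rewrite mulr_ge0 ?sqr_ge0 ?(ltW hy).
have h3 : 0 <= y ^+ 2 * (1 - x ^+ 2) by rewrite mulr_ge0 ?sqr_ge0 ?(ltW hx).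
lra.
Qed.

(** With [P = (1 - p) (1 - q)], the difference quotient is [(1 - p q) / P^2], and
    [P^2 <= P <= 1 - p q] because [1 - p q - P = p (1 - q) + q (1 - p)]. *)
Lemma square_odds_expanding (p q : R) : 0 <= p < 1 -> 0 <= q < 1 -> p < q ->
  q - p <= q / (1 - q) ^+ 2 - p / (1 - p) ^+ 2.
Proof.
move=> /andP[p0 p1] /andP[q0 q1] pq.
have hp : 0 < 1 - p by lra.
have hq : 0 < 1 - q by lra.
have -> : q / (1 - q) ^+ 2 - p / (1 - p) ^+ 2 =
    (q - p) * (1 - p * q) / ((1 - p) ^+ 2 * (1 - q) ^+ 2).
  by field; rewrite !gt_eqF.
rewrite ler_pdivlMr ?mulr_gt0 ?exprn_gt0// ler_pM2l ?subr_gt0//.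
have h0 : 0 <= (1 - p) * (1 - q) by rewrite mulr_ge0// ltW.
have h1 : (1 - p) * (1 - q) <= 1 by rewrite mulr_ile1; lra.
have h2 : 0 <= p * (1 - q) by rewrite mulr_ge0// ltW.
have h3 : 0 <= q * (1 - p) by rewrite mulr_ge0// ltW.
have : ((1 - p) * (1 - q)) * ((1 - p) * (1 - q)) <= (1 - p) * (1 - q).
  by rewrite ler_piMr.
lra.
Qed.

Variables (lambda alpha kappa L : R) (F A B : R -> R -> R).
Hypotheses (lambda_gt0 : 0 < lambda) (alpha_gt0 : 0 < alpha) (L_ge0 : 0 <= L).
Hypothesis kappaE : kappa = alpha * lambda.
(** The 12 makes the maps with Lipschitz constant [3 kappa L] contract by [1/4]. Writing [L + 1]
    instead of [L] makes [12 kappa L < 1] strict and the threshold on [alpha] finite even if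
    [L = 0]. *)
Hypothesis small : 12 * (kappa * (L + 1)) <= 1.
Hypothesis A_itv : forall x q : R, -1 < x < 1 -> 0 <= q < 1 -> 0 <= A x q <= L.
Hypothesis B_itv : forall x q : R, -1 < x < 1 -> 0 <= q < 1 -> 0 <= B x q <= L.
Hypothesis A_lip : forall x x' q q' : R,
  -1 < x < 1 -> -1 < x' < 1 -> 0 <= q < 1 -> 0 <= q' < 1 ->
  `|A x q - A x' q'| <= L * (`|x - x'| + `|q - q'|).
Hypothesis B_lip : forall x x' q q' : R,
  -1 < x < 1 -> -1 < x' < 1 -> 0 <= q < 1 -> 0 <= q' < 1 ->
  `|B x q - B x' q'| <= L * (`|x - x'| + `|q - q'|).
Hypothesis F_derive_x : forall x q : R, -1 < x < 1 -> 0 <= q < 1 ->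
  is_derive x 1 (F^~ q) (lambda * (A x q - x * (1 - q) * B x q)).
Hypothesis F_derive_q : forall x q : R, -1 < x < 1 -> 0 < q < 1 ->
  is_derive q 1 (F x) (- (lambda * (1 - x ^+ 2) * B x q) / 2).
Hypothesis F_continuous_q : forall x q : R, -1 < x < 1 -> 0 <= q < 1 ->
  {for q, continuous (F x)}.

Let kappa_gt0 : 0 < kappa. Proof. by rewrite kappaE mulr_gt0. Qed.
Let kL : kappa * L * 12 < 1.
Proof. by move: kappa_gt0 small; lra. Qed.

Definition free_energy (x q : R) : R := alpha * F x q
  + 1 / 2 * (q / (1 - q)) + 1 / 2 * ln ((1 - x ^+ 2) * (1 - q)).

(** Clearing denominators turns the system into the fixed point problem [x = kappa fS A],
    [q = kappa fT B], whose right-hand sides are small and have small Lipschitz constants. *)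
Lemma critical_point_exists : exists x q, [/\ 0 <= x <= 2^-1, 0 <= q <= 2^-1,
  kappa * (1 - q) * A x q = x / (1 - x ^+ 2) &
  kappa * (1 - x ^+ 2) * B x q = q / (1 - q) ^+ 2].
Proof.
pose fS (x q : R) := (1 - q) * (1 - x ^+ 2).
pose fT (x q : R) := (1 - x ^+ 2) * (1 - q) ^+ 2.
have k0 := ltW kappa_gt0.
have x11 (x : R) : 0 <= x <= 2^-1 -> -1 < x < 1 by lra.
have q01 (q : R) : 0 <= q <= 2^-1 -> 0 <= q < 1 by lra.
have sx (x : R) : 0 <= x <= 2^-1 -> 0 <= 1 - x ^+ 2 <= 1.
  by move=> /x11/sqr_lt1; have := sqr_ge0 x; lra.
have sq (q : R) : 0 <= q <= 2^-1 -> 0 <= (1 - q) ^+ 2 <= 1.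
  move=> qI; rewrite sqr_ge0 exprn_ile1//; lra.
have fS01 x q : 0 <= x <= 2^-1 -> 0 <= q <= 2^-1 -> 0 <= fS x q <= 1.
  move=> /sx/andP[x0 x1] qI; rewrite /fS mulr_ge0 ?mulr_ile1//; lra.
have fT01 x q : 0 <= x <= 2^-1 -> 0 <= q <= 2^-1 -> 0 <= fT x q <= 1.
  move=> /sx/andP[x0 x1] /sq/andP[q0 q1].
  by rewrite /fT mulr_ge0//= mulr_ile1.
have prod_itv (f h : R) : 0 <= f <= 1 -> 0 <= h <= L -> 0 <= kappa * (f * h) <= 2^-1.
  move=> /andP[f0 f1] /andP[h0 h1].
  apply/andP; split; first by rewrite mulr_ge0// mulr_ge0.
  have : f * h <= 1 * L by rewrite ler_pM.
  by move=> /(ler_wpM2l k0); move: kL; lra.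
(* This is where the side [1/2] of the square matters: [x + x' <= 1]. *)
have sqlip (x x' : R) : 0 <= x <= 2^-1 -> 0 <= x' <= 2^-1 ->
    `|x ^+ 2 - x' ^+ 2| <= `|x - x'|.
  by move=> xI xI'; rewrite subr_sqr normrM ler_piMr// ger0_norm; lra.
have fSlip x q x' q' : 0 <= x <= 2^-1 -> 0 <= q <= 2^-1 ->
    0 <= x' <= 2^-1 -> 0 <= q' <= 2^-1 ->
    `|fS x q - fS x' q'| <= 2 * (`|x - x'| + `|q - q'|).
  move=> xI qI xI' qI'; rewrite /fS.
  have -> : (1 - q) * (1 - x ^+ 2) - (1 - q') * (1 - x' ^+ 2) =
    - ((q - q') * (1 - x ^+ 2) + (1 - q') * (x ^+ 2 - x' ^+ 2)) by ring.
  rewrite normrN (le_trans (ler_normD _ _))// !normrM.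
  have [x0 x1] := andP (sx x xI).
  have p1 : `|q - q'| * `|1 - x ^+ 2| <= `|q - q'|.
    by rewrite ler_piMr// ger0_norm.
  have p2 : `|1 - q'| * `|x ^+ 2 - x' ^+ 2| <= `|x - x'|.
    rewrite -[leRHS]mul1r ler_pM ?sqlip// ger0_norm; lra.
  have := normr_ge0 (x - x'); have := normr_ge0 (q - q'); lra.
have fTlip x q x' q' : 0 <= x <= 2^-1 -> 0 <= q <= 2^-1 ->
    0 <= x' <= 2^-1 -> 0 <= q' <= 2^-1 ->
    `|fT x q - fT x' q'| <= 2 * (`|x - x'| + `|q - q'|).
  move=> xI qI xI' qI'; rewrite /fT.
  have -> : (1 - x ^+ 2) * (1 - q) ^+ 2 - (1 - x' ^+ 2) * (1 - q') ^+ 2 =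
    - ((1 - x' ^+ 2) * ((2 - q - q') * (q - q')) +
       (1 - q) ^+ 2 * (x ^+ 2 - x' ^+ 2)) by ring.
  rewrite normrN (le_trans (ler_normD _ _))// (normrM (1 - x' ^+ 2)).
  rewrite (normrM (2 - q - q')) (normrM ((1 - q) ^+ 2)).
  have [x0 x1] := andP (sx x' xI'); have [q0 q1] := andP (sq q qI).
  have p1 : `|1 - x' ^+ 2| * (`|2 - q - q'| * `|q - q'|) <= 2 * `|q - q'|.
    rewrite mulrA ler_wpM2r// -[leRHS]mul1r ler_pM// ger0_norm//; lra.
  have p2 : `|(1 - q) ^+ 2| * `|x ^+ 2 - x' ^+ 2| <= `|x - x'|.
    rewrite -[leRHS]mul1r ler_pM ?sqlip// ger0_norm//.
  rewrite (le_trans (lerD p1 p2))//.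
  have := normr_ge0 (x - x'); lra.
have scale (a b : R) (n : R) : 0 <= n -> `|a - b| <= 3 * L * n ->
    `|kappa * a - kappa * b| <= 4^-1 * n.
  move=> n0 ab; rewrite -mulrBr normrM (gtr0_norm kappa_gt0).
  rewrite (le_trans (ler_wpM2l k0 ab))// !mulrA ler_wpM2r//.
  by move: kL; lra.
have [||x [q [xI qI Sx Tq]]] := @square_contraction_fixpoint R
    (fun x q => kappa * (fS x q * A x q)) (fun x q => kappa * (fT x q * B x q)).
- move=> x q xI qI; have x1 := x11 x xI; have q1 := q01 q qI.
  by split; apply: prod_itv; [exact: fS01|exact: A_itv|exact: fT01|exact: B_itv].
- move=> x q x' q' xI qI xI' qI'.
  have x1 := x11 x xI; have q1 := q01 q qI.
  have x1' := x11 x' xI'; have q1' := q01 q' qI'.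
  split; (apply: scale; first by rewrite addr_ge0).
  + apply: (@scaled_product_lipschitz _ L fS A); [exact: fS01|exact: fS01|exact: A_itv|
      exact: A_itv|exact: fSlip|exact: A_lip].
  + apply: (@scaled_product_lipschitz _ L fT B); [exact: fT01|exact: fT01|exact: B_itv|
      exact: B_itv|exact: fTlip|exact: B_lip].
have hx := sqr_lt1 (x11 x xI).
have hq : 0 < 1 - q by lra.
exists x, q; split => //.
- have hx0 : 1 - x ^+ 2 != 0 by rewrite gt_eqF.
  by apply: (mulIf hx0); rewrite divfK// -[RHS]Sx /fS; ring.
- have hq0 : (1 - q) ^+ 2 != 0 by rewrite gt_eqF// exprn_gt0.
  by apply: (mulIf hq0); rewrite divfK// -[RHS]Tq /fT; ring.
Qed.

Lemma free_energy_derive_x (x q : R) : -1 < x < 1 -> 0 <= q < 1 ->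
  is_derive x 1 (free_energy^~ q)
    (kappa * (A x q - x * (1 - q) * B x q) - x / (1 - x ^+ 2)).
Proof.
move=> x1 /[dup] qI /andP[q0 q1]; have hx := sqr_lt1 x1.
have dF := F_derive_x x1 qI.
have hq : 0 < 1 - q by lra.
have hp : 0 < (1 - x ^+ 2) * (1 - q) by rewrite mulr_gt0.
have dl := is_derive1_ln hp.
have dp : is_derive x 1 (fun x : R => (1 - x ^+ 2) * (1 - q)) (- (2 * x) * (1 - q)).
  by apply: is_derive_eq; rewrite /GRing.scale/=; ring.
have dlp := @is_derive1_comp R (@ln R)
  (fun x : R => (1 - x ^+ 2) * (1 - q)) x _ _ dl dp.
have dlp' : is_derive x 1 (fun x : R => ln ((1 - x ^+ 2) * (1 - q)))
  (((1 - x ^+ 2) * (1 - q))^-1 * (- (2 * x) * (1 - q))) by exact: dlp.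
rewrite /free_energy; apply: is_derive_eq.
rewrite kappaE /GRing.scale/=; field.
by rewrite !gt_eqF.
Qed.

(** Kept apart from [F] because it also holds at [q = 0], where it gives the continuity of the
    entropic part while [F x] is merely assumed continuous. *)
Lemma entropy_derive_q (x q : R) : -1 < x < 1 -> 0 <= q < 1 ->
  is_derive q 1 (fun q : R => 1 / 2 * (q / (1 - q)) +
    1 / 2 * ln ((1 - x ^+ 2) * (1 - q))) (q / (1 - q) ^+ 2 / 2).
Proof.
move=> x1 /andP[q0 q1]; have hx := sqr_lt1 x1.
have hq : 0 < 1 - q by lra.
have hp : 0 < (1 - x ^+ 2) * (1 - q) by rewrite mulr_gt0.
have dl := is_derive1_ln hp.
have dp : is_derive q 1 (fun q : R => (1 - x ^+ 2) * (1 - q)) (- (1 - x ^+ 2)).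
  by apply: is_derive_eq; rewrite /GRing.scale/=; ring.
have dlp' : is_derive q 1 (fun q : R => ln ((1 - x ^+ 2) * (1 - q)))
  (((1 - x ^+ 2) * (1 - q))^-1 * - (1 - x ^+ 2)).
  exact: (@is_derive1_comp R (@ln R) (fun q : R => (1 - x ^+ 2) * (1 - q))
    q _ _ dl dp).
have d1 : is_derive q 1 (fun q : R => 1 - q) (-1).
  by apply: is_derive_eq; rewrite /GRing.scale/=; ring.
have dq : is_derive q 1 (fun q : R => q / (1 - q)) ((1 - q / (1 - q) * -1) / (1 - q)).
  apply: (@is_derive_quotient R id (fun q => 1 - q)) => //.
  by rewrite gt_eqF.
apply: is_derive_eq.
rewrite /GRing.scale/=; field.
by rewrite !gt_eqF.
Qed.

Lemma free_energy_derive_q (x q : R) : -1 < x < 1 -> 0 < q < 1 ->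
  is_derive q 1 (free_energy x)
    ((q / (1 - q) ^+ 2 - kappa * (1 - x ^+ 2) * B x q) / 2).
Proof.
move=> x1 q1; have q01 : 0 <= q < 1 by lra.
have dF := F_derive_q x1 q1; have dE := entropy_derive_q x1 q01.
have -> : free_energy x = (fun q => alpha * F x q + (1 / 2 * (q / (1 - q)) +
    1 / 2 * ln ((1 - x ^+ 2) * (1 - q)))).
  by apply/funext => y; rewrite /free_energy addrA.
apply: is_derive_eq.
by rewrite kappaE /GRing.scale/=; field; lra.
Qed.

Lemma free_energy_continuous_q (x q : R) : -1 < x < 1 -> 0 <= q < 1 ->
  {for q, continuous (free_energy x)}.
Proof.
move=> x1 q1.
have -> : free_energy x = (fun q => alpha * F x q + (1 / 2 * (q / (1 - q)) +
    1 / 2 * ln ((1 - x ^+ 2) * (1 - q)))).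
  by apply/funext => y; rewrite /free_energy addrA.
apply: cvgD.
  by apply: cvgM; [exact: cvg_cst|exact: F_continuous_q].
exact: (is_derive_continuous_at (entropy_derive_q x1 q1)).
Qed.

(** On each slice the derivative vanishes at the critical point. Moving away by [d], the entropic
    part changes by at least [d] and the rest by at most [kappa L d] in [q], [3 kappa L d] in [x],
    so the entropic part fixes the sign. *)
Lemma free_energy_saddle : exists xs qs, [/\ 0 <= xs < 1 /\ 0 <= qs < 1,
  kappa * (1 - qs) * A xs qs = xs / (1 - xs ^+ 2),
  kappa * (1 - xs ^+ 2) * B xs qs = qs / (1 - qs) ^+ 2,
  forall q, 0 <= q < 1 -> q != qs -> free_energy xs qs < free_energy xs q &
  forall x, -1 < x < 1 -> x != xs -> free_energy x qs < free_energy xs qs].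
Proof.
have [xs [qs [xI qI Ex Eq]]] := critical_point_exists.
have x1 : -1 < xs < 1 by lra.
have q1 : 0 <= qs < 1 by lra.
have hx := sqr_lt1 x1.
have hq : 0 < 1 - qs by lra.
have k0 := ltW kappa_gt0.
exists xs, qs; split => //; first by split; lra.
- pose D q := q / (1 - q) ^+ 2 - kappa * (1 - xs ^+ 2) * B xs q.
  have D0 : D qs = 0 by rewrite /D Eq subrr.
  have Binc q : 0 <= q < 1 ->
      `|kappa * (1 - xs ^+ 2) * B xs q - kappa * (1 - xs ^+ 2) * B xs qs|
      <= kappa * L * `|q - qs|.
    move=> qI'; rewrite -mulrBr 2!normrM (gtr0_norm kappa_gt0) (gtr0_norm hx).
    have := B_lip x1 x1 qI' q1; rewrite subrr normr0 add0r => BL.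
    rewrite -!mulrA ler_wpM2l// -[leRHS]mul1r ler_pM//; first exact: ltW.
    by have := sqr_ge0 xs; lra.
  have cont (u v : R) : 0 <= u -> v < 1 ->
      {in `[u, v]%classic, continuous (free_energy xs)}.
    move=> u0 v1 z; rewrite inE/= in_itv/= => /andP[uz zv].
    by apply: free_energy_continuous_q; lra.
  move=> q /[dup] qI' /andP[q0 q11]; rewrite neq_lt => /orP[qqs|qqs].
    apply: (@derive_gt R _ (fun z => D z / 2)) qqs _ _ _.
    + by apply: cont; lra.
    + by move=> z z1 z2; apply: free_energy_derive_q; lra.
    + move=> z z1 z2; rewrite pmulr_llt0// -D0 /D.
      have zI : 0 <= z < 1 by lra.
      have := square_odds_expanding zI q1 z2.
      have := Binc z zI.
      have zq : 0 < qs - z by lra.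
      have : kappa * L * (qs - z) < qs - z.
        by rewrite gtr_pMl//; move: kL; have := mulr_ge0 k0 L_ge0; lra.
      rewrite (distrC z) (gtr0_norm zq) => h1 /ler_normlP[h2 h3] h4.
      lra.
  apply: (@derive_lt R _ (fun z => D z / 2)) qqs _ _ _.
  + by apply: cont; lra.
  + by move=> z z1 z2; apply: free_energy_derive_q; lra.
  + move=> z z1 z2; rewrite pmulr_lgt0// -D0 /D.
    have zI : 0 <= z < 1 by lra.
    have := square_odds_expanding q1 zI z1.
    have := Binc z zI.
    have zq : 0 < z - qs by lra.
    have : kappa * L * (z - qs) < z - qs.
      by rewrite gtr_pMl//; move: kL; have := mulr_ge0 k0 L_ge0; lra.
    rewrite (gtr0_norm zq) => h1 /ler_normlP[h2 h3] h4.
    lra.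
- pose D x := kappa * (A x qs - x * (1 - qs) * B x qs) - x / (1 - x ^+ 2).
  (* The [x]-derivative involves both A and B, so both critical equations enter: they turn it into
     [x / (1 - x^2)] times [1 / (1 - q) - q / (1 - q) - 1 = 0]. *)
  have D0 : D xs = 0.
    have EA : kappa * A xs qs = xs / (1 - xs ^+ 2) / (1 - qs).
      by rewrite -Ex; field; rewrite gt_eqF.
    have EB : kappa * B xs qs = qs / (1 - qs) ^+ 2 / (1 - xs ^+ 2).
      by rewrite -Eq; field; rewrite gt_eqF.
    rewrite /D mulrBr EA mulrCA EB; field.
    by rewrite !gt_eqF.
  (* The 3 counts one [L] for the variation of [A] and two for the product [x B], one from each
     factor. *)
  have inc x : -1 < x < 1 ->
      `|kappa * (A x qs - x * (1 - qs) * B x qs) -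
        kappa * (A xs qs - xs * (1 - qs) * B xs qs)|
      <= kappa * L * 3 * `|x - xs|.
    move=> xI'; rewrite -mulrBr normrM (gtr0_norm kappa_gt0) -!mulrA ler_wpM2l//.
    have -> : A x qs - x * ((1 - qs) * B x qs) -
        (A xs qs - xs * ((1 - qs) * B xs qs)) =
      (A x qs - A xs qs) - (1 - qs) * ((x - xs) * B x qs +
        xs * (B x qs - B xs qs)) by ring.
    have := A_lip xI' x1 q1 q1; have := B_lip xI' x1 q1 q1.
    rewrite subrr normr0 addr0 => BL AL.
    have [B0 B1] := andP (B_itv xI' q1).
    rewrite (le_trans (ler_normB _ _))//.
    have p1 : `|(x - xs) * B x qs + xs * (B x qs - B xs qs)| <=
        2 * (L * `|x - xs|).
      rewrite (le_trans (ler_normD _ _))// !normrM (ger0_norm B0).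
      have : `|x - xs| * B x qs <= `|x - xs| * L by rewrite ler_wpM2l.
      have : `|xs| * `|B x qs - B xs qs| <= 1 * (L * `|x - xs|).
        by rewrite ler_pM// ger0_norm; lra.
      lra.
    have p2 : `|(1 - qs) * ((x - xs) * B x qs + xs * (B x qs - B xs qs))| <=
        1 * (2 * (L * `|x - xs|)).
      by rewrite normrM ler_pM// ger0_norm; lra.
    lra.
  have cont (u v : R) : -1 < u -> v < 1 ->
      {in `[u, v]%classic, continuous (free_energy^~ qs)}.
    move=> u0 v1 z; rewrite inE/= in_itv/= => /andP[uz zv].
    have zI : -1 < z < 1 by lra.
    exact: (is_derive_continuous_at (free_energy_derive_x zI q1)).
  move=> x /[dup] xI' /andP[x0 x11]; rewrite neq_lt => /orP[xxs|xxs].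
    apply: (@derive_lt R (free_energy^~ qs) D) xxs _ _ _.
    + by apply: cont; lra.
    + by move=> z z1 z2; apply: free_energy_derive_x; lra.
    + move=> z z1 z2; rewrite -D0 /D.
      have zI : -1 < z < 1 by lra.
      have := odds_expanding zI x1 z2.
      have := inc z zI.
      have zx : 0 < xs - z by lra.
      have : kappa * L * 3 * (xs - z) < xs - z.
        by rewrite gtr_pMl//; move: kL; have := mulr_ge0 k0 L_ge0; lra.
      rewrite (distrC z) (gtr0_norm zx) => h1 /ler_normlP[h2 h3] h4.
      lra.
  apply: (@derive_gt R (free_energy^~ qs) D) xxs _ _ _.
  + by apply: cont; lra.
  + by move=> z z1 z2; apply: free_energy_derive_x; lra.
  + move=> z z1 z2; rewrite -D0 /D.
    have zI : -1 < z < 1 by lra.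
    have := odds_expanding x1 zI z1.
    have := inc z zI.
    have zx : 0 < z - xs by lra.
    have : kappa * L * 3 * (z - xs) < z - xs.
      by rewrite gtr_pMl//; move: kL; have := mulr_ge0 k0 L_ge0; lra.
    rewrite (gtr0_norm zx) => h1 /ler_normlP[h2 h3] h4.
    lra.
Qed.

End small_coupling.

Theorem proposition3p7 (R : realType) (lambda : R) (lambda_gt0 : 0 < lambda) :
  exists2 alpha0 : R, 0 < alpha0 &
    forall alpha : R, 0 < alpha -> alpha < alpha0 ->
      exists xBayes qBayes : R,
        [/\ uniquely_achieved (Phi lambda alpha) xBayes qBayes,
            alpha * lambda * (1 - qBayes) *
              EYGZ lambda (fun y g z =>
                phi (- Num.sqrt lambda * y * g) *
                Rratio lambda xBayes qBayes y g z)
            = xBayes / (1 - xBayes ^+ 2) &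
            alpha * lambda * (1 - xBayes ^+ 2) *
              EYGZ lambda (fun y g z =>
                (Rratio lambda xBayes qBayes y g z) ^+ 2)
            = qBayes / (1 - qBayes) ^+ 2].
Proof.
have [L L0 [hA hB]] := regular_overlaps lambda_gt0.
have D0 : 0 < 12 * (lambda * (L + 1)) by rewrite !mulr_gt0// ltr_wpDl.
(* The bound [L] depends on [lambda] only, so this threshold may be fixed before [alpha]. *)
exists (12 * (lambda * (L + 1)))^-1; first by rewrite invr_gt0.
move=> alpha alpha_gt0 alpha_lt.
have small : 12 * (alpha * lambda * (L + 1)) <= 1.
  have -> : 12 * (alpha * lambda * (L + 1)) =
    alpha * (12 * (lambda * (L + 1))) by ring.
  by rewrite -ler_pdivlMr// div1r ltW.
pose F (x q : R) := potential lambda x (Num.sqrt q).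
pose A (x q : R) := overlap_signal lambda x (Num.sqrt q).
pose B (x q : R) := overlap_noise lambda x (Num.sqrt q).
have A_itv (x q : R) : -1 < x < 1 -> 0 <= q < 1 -> 0 <= A x q <= L.
  by move=> x1 q1; have [+ _ _] := hA x _ x1 (sqrt_itv q1).
have B_itv (x q : R) : -1 < x < 1 -> 0 <= q < 1 -> 0 <= B x q <= L.
  by move=> x1 q1; have [+ _ _] := hB x _ x1 (sqrt_itv q1).
have F_x (x q : R) : -1 < x < 1 -> 0 <= q < 1 ->
    is_derive x 1 (F^~ q) (lambda * (A x q - x * (1 - q) * B x q)).
  move=> x1 q1; have q0 : 0 <= q by case/andP: q1.
  have := is_derive_potential_x lambda_gt0 x1 (sqrt_itv q1).
  by rewrite sqr_sqrtr.
have F_q (x q : R) : -1 < x < 1 -> 0 < q < 1 ->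
    is_derive q 1 (F x) (- (lambda * (1 - x ^+ 2) * B x q) / 2).
  move=> x1 /andP[q0 q1]; have qI : 0 <= q < 1 by rewrite (ltW q0).
  have dp := is_derive_potential_t lambda_gt0 x1 (sqrt_itv qI).
  exact: (@is_derive_comp_sqrt _ (potential lambda x) q _ q0 dp).
have F_cont (x q : R) : -1 < x < 1 -> 0 <= q < 1 ->
    {for q, continuous (F x)}.
  move=> x1 qI.
  have dp := is_derive_potential_t lambda_gt0 x1 (sqrt_itv qI).
  exact: (@continuous_comp_sqrt _ (potential lambda x) q
    (is_derive_continuous_at dp)).
have [xs [qs [[x01 q01] EA EB Fq Fx]]] := free_energy_saddle lambda_gt0
  alpha_gt0 L0 erefl small A_itv B_itv (regular_lipschitz L0 hA)
  (regular_lipschitz L0 hB) F_x F_q F_cont.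
have x11 : -1 < xs < 1 by lra.
have PhiF (x q : R) : -1 < x < 1 -> 0 <= q < 1 ->
    Phi lambda alpha x q = free_energy alpha F x q.
  by move=> x1 q1; rewrite PhiE.
exists xs, qs; split.
- apply: uniquely_achievedP => // [q q1 qqs|x x1 xxs].
    by rewrite !PhiF//; exact: Fq.
  by rewrite !PhiF//; exact: Fx.
- by rewrite overlap_signalE.
- by rewrite overlap_noiseE.
Qed.
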